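(* For every integer $u\geq 3$ there exists a polytopal sphere $\Delta\in S(u,2u-1)$ such that, for every embedding $p:V(\Delta)\to\mathbb{R}^{2u}$ that is either generic or natural, the ring $A(\Delta)=\mathbb{R}[\Delta]/(\theta_1,\dots,\theta_{2u},c)$ associated with $p$ is not level. Consequently, for $d=2u\geq 6$ the following assertion is false: ''for every $(d-1)$-sphere $\Delta\in S(d-u,d-1)$ with a generic or natural embedding $p$ in $\mathbb{R}^d$ and all $1\leq j<i\leq u$, $$\mathcal{S}^a_{j}(\Delta,p)=\{\partial_{\mu}\omega : \omega\in \mathcal{S}^a_i(\Delta,p),\ \mu\in R_{i-j}\}.''$$
   Context: All simplicial complexes are finite. A missing face of a simplicial complex is a set of vertices that is not a face but all of whose proper subsets are faces; its dimension is its cardinality minus $1$. A $(d-1)$-sphere means a $\mathbb{Z}/2\mathbb{Z}$-homology sphere: a pure $(d-1)$-dimensional simplicial complex such that for every face $\sigma$ (including $\emptyset$), the link $\mathrm{lk}(\sigma)=\{\tau\in\Delta:\tau\cup\sigma\in\Delta,\tau\cap\sigma=\emptyset\}$ has the $\mathbb{Z}/2\mathbb{Z}$-homology of a $(d-1-|\sigma|)$-dimensional sphere. It is polytopal if it is the boundary complex of a simplicial $d$-polytope. $S(j,d-1)$ denotes the set of $(d-1)$-spheres all of whose missing faces have dimension at most $j$. Let $\Delta$ be a $(d-1)$-sphere with vertex set $V$. An embedding is a map $p:V\to\mathbb{R}^d$. It is generic if the coordinates $\{p(v)_j:v\in V,j\in[d]\}$ are algebraically independent over $\mathbb{Q}$.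 It is natural if $\Delta$ is realized as the boundary complex of a simplicial $d$-polytope $P\subset\mathbb{R}^d$ and $p(v)$ is the corresponding vertex of $P$. Let $R=\mathbb{R}[x_v:v\in V]$, with $R_k$ its degree-$k$ component; $I_\Delta$ is the ideal generated by the monomials $\prod_{v\in\tau}x_v$ over missing faces $\tau$; $\mathbb{R}[\Delta]=R/I_\Delta$; $\theta_j=\sum_{v}p(v)_jx_v$ for $1\le j\le d$; $c=\sum_v x_v$; $A(\Delta)=\mathbb{R}[\Delta]/(\theta_1,\dots,\theta_d,c)$. For an Artinian graded quotient ring $N=\mathbb{R}\oplus N_1\oplus\dots\oplus N_s$ ($N_s\neq0$) of $R$, the socle is $\{y\in N: x_vy=0\ \forall v\}$, and $N$ is level if its socle equals $N_s$. For a monomial $\mu=x_{i_1}\cdots x_{i_s}$, $\partial_\mu=\partial_{x_{i_1}}\cdots\partial_{x_{i_s}}$ acts on $R$ by partial differentiation, extended linearly to all $\mu\in R$. An affine $k$-stress on $(\Delta,p)$ is a homogeneous polynomial $\lambda\in R$ of degree $k$ such that every monomial appearing in $\lambda$ with nonzero coefficient has support $\{v:x_v\mid\mu\}$ a face of $\Delta$, $\partial_{\theta_i}\lambda=0$ for $i=1,\dots,d$, and $\partial_c\lambda=0$. $\mathcal{S}^a_k(\Delta,p)$ is the vector space of affine $k$-stresses. *)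

(* Defs.v *)
From HB Require Import structures.
From mathcomp Require Import all_boot all_order all_algebra.
From mathcomp Require Import boolp reals.
From mathcomp Require Import mpoly.

Set Implicit Arguments.
Unset Strict Implicit.
Unset Printing Implicit Defensive.

Import Order.TTheory GRing.Theory Num.Theory.
Local Open Scope ring_scope.
Local Open Scope quotient_scope.

(** * Simplicial complexes and Z/2-homology spheres *)

(* The vertex set is exactly 'I_n: every singleton is a face. *)
Record complex (n : nat) := Complex {
  faces :> {set {set 'I_n}};
  complex0 : set0 \in faces;
  complex1 : forall v, [set v] \in faces;
  complexS : forall s t : {set 'I_n}, t \subset s -> s \in faces -> t \in faces
}.

Section Homology.
Variable n : nat.
Implicit Types (K : {set {set 'I_n}}) (s t : {set 'I_n}).

Definition link K s : {set {set 'I_n}} :=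
  [set t in K | (t :|: s \in K) && [disjoint t & s]].

(* Chains are row vectors over F_2 indexed by all subsets of 'I_n, and
   [boundary] sends the basis vector of s to the sum of those of s :\ v, v in s.
   [chains K k] has as row space the span of the faces of K with k vertices,
   i.e. the simplicial chains of dimension k - 1; the empty face is a chain of
   dimension -1, so the homology is reduced. *)
Definition subset_of (a : 'I_#|{: {set 'I_n}}|) : {set 'I_n} := enum_val a.

Definition boundary : 'M['F_2]_#|{: {set 'I_n}}| :=
  \matrix_(a, b) ((subset_of b \subset subset_of a)
                  && (#|subset_of a| == #|subset_of b|.+1))%:R.

Definition chains K (k : nat) : 'M['F_2]_#|{: {set 'I_n}}| :=
  \matrix_(a, b) [&& a == b, subset_of a \in K & #|subset_of a| == k]%:R.

Definition cycles K k := (chains K k :&: kermx boundary)%MS.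
Definition boundaries K k := chains K k.+1 *m boundary.

(* Dimension over F_2 of the reduced homology of K in dimension k - 1. *)
Definition betti K k : nat := \rank (cycles K k) - \rank (boundaries K k).

(* Pure of dimension d - 1, and the link of each face s has the reduced
   homology of a sphere of dimension d - 1 - #|s|. *)
Definition homology_sphere (d : nat) (K : complex n) : Prop :=
  [/\ forall s, s \in faces K ->
        (forall t, t \in faces K -> s \subset t -> t = s) -> #|s| = d
    & forall s, s \in faces K ->
        forall k, betti (link K s) k = (k + #|s| == d)%N ].

Definition missing_face (K : complex n) s : Prop :=
  s \notin faces K /\ forall t, t \proper s -> t \in faces K.

(* [sphere_class j d K] is membership in S(j, d - 1). *)
Definition sphere_class (j d : nat) (K : complex n) : Prop :=
  homology_sphere d K /\ forall s, missing_face K s -> (#|s|.-1 <= j)%N.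

End Homology.

(** * Embeddings and polytopes *)

Section Embedding.
Variables (R : realType) (n d : nat).
Implicit Types (p : 'I_n -> 'rV[R]_d) (P F : 'rV[R]_d -> Prop) (K : complex n).

Definition alg_independent (I : finType) (x : I -> R) : Prop :=
  forall q : {mpoly rat[#|I|]},
    (map_mpoly (ratr : rat -> R) q).@[fun k => x (enum_val k)] = 0 -> q = 0.

Definition generic p : Prop :=
  alg_independent (fun vj : 'I_n * 'I_d => p vj.1 0 vj.2).

Definition conv p (x : 'rV[R]_d) : Prop :=
  exists w : 'I_n -> R,
    [/\ forall v, 0 <= w v, \sum_v w v = 1 & x = \sum_v w v *: p v].

(* Includes the empty face and P itself. *)
Definition polytope_face P F : Prop :=
  exists (a : 'cV[R]_d) (b : R),
    (forall x, P x -> (x *m a) 0 0 <= b)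
    /\ (forall x, F x <-> P x /\ (x *m a) 0 0 = b).

Definition proper_face P F : Prop :=
  polytope_face P F /\ exists x, P x /\ ~ F x.

Definition polytope_vertex P x : Prop := polytope_face P (fun y => y = x).

Definition full_dimensional p : Prop :=
  forall x : 'rV[R]_d, exists w : 'I_n -> R,
    \sum_v w v = 1 /\ x = \sum_v w v *: p v.

Definition affinely_independent p (s : {set 'I_n}) : Prop :=
  forall w : 'I_n -> R, (forall v, v \notin s -> w v = 0) ->
    \sum_v w v = 0 -> \sum_v w v *: p v = 0 -> forall v, w v = 0.

Definition face_vertices p F (s : {set 'I_n}) : Prop :=
  forall v, v \in s <-> F (p v).

(* P = conv p is a d-polytope whose vertices are the p v, without repetition;
   it is simplicial, and the faces of K are the vertex sets of its proper faces. *)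
Definition natural K p : Prop :=
  [/\ injective p /\
        (forall x, polytope_vertex (conv p) x <-> exists v, x = p v),
      full_dimensional p,
      forall F s, proper_face (conv p) F -> face_vertices p F s ->
        affinely_independent p s
    & forall s, s \in faces K <->
        exists F, proper_face (conv p) F /\ face_vertices p F s ].

End Embedding.

Definition polytopal (R : realType) (n d : nat) (K : complex n) : Prop :=
  exists p : 'I_n -> 'rV[R]_d, natural K p.

(** * The ring A(K) *)

Definition in_ideal (A : comNzRingType) (G : A -> Prop) (f : A) : Prop :=
  exists s : seq (A * A),
    (forall hg, hg \in s -> G hg.2) /\ f = \sum_(hg <- s) hg.1 * hg.2.

Section Ring.
Variables (R : realType) (n d : nat).
Implicit Types (p : 'I_n -> 'rV[R]_d) (K : complex n).

Definition theta p (j : 'I_d) : {mpoly R[n]} := \sum_v p v 0 j *: 'X_v.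

Definition csum : {mpoly R[n]} := \sum_v 'X_v.

Definition face_ideal_gen K (g : {mpoly R[n]}) : Prop :=
  exists s, missing_face K s /\ g = \prod_(v in s) 'X_v.

Definition affine_gen K p (g : {mpoly R[n]}) : Prop :=
  [\/ face_ideal_gen K g, exists j, g = theta p j | g = csum].

Definition affine_ideal K p : {pred {mpoly R[n]}} :=
  fun f => `[< in_ideal (affine_gen K p) f >].

Lemma mcoeff0X (v : 'I_n) : ('X_v : {mpoly R[n]})@_0%MM = 0.
Proof. by rewrite mcoeffX mnm1_eq0. Qed.

Lemma affine_gen0 K p g : affine_gen K p g -> g@_0%MM = 0.
Proof.
case=> [[s [[sK _] ->]]|[j ->]|->].
- have /set0Pn[v vs] : s != set0.
    by apply: contra sK => /eqP ->; exact: complex0.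
  by rewrite (bigD1 v) //= rmorphM /= mcoeff0X mul0r.
- rewrite raddf_sum big1 //= => v _.
  by rewrite mcoeffZ mcoeff0X mulr0.
- by rewrite raddf_sum big1 //= => v _; exact: mcoeff0X.
Qed.

Lemma affine_idealr_closed K p : idealr_closed (affine_ideal K p).
Proof.
split.
- by apply/asboolP; exists [::]; rewrite big_nil.
- apply/asboolP => -[s [sG /(congr1 (mcoeff 0%MM))/eqP]].
  rewrite mcoeff1 eqxx raddf_sum big_seq big1 ?oner_eq0 //= => hg /sG hG.
  by rewrite rmorphM /= (affine_gen0 hG) mulr0.
- move=> a f g /asboolP[s [sG ->]] /asboolP[t [tG ->]]; apply/asboolP.
  exists ([seq (a * hg.1, hg.2) | hg <- s] ++ t); split.
    by move=> hg; rewrite mem_cat => /orP[/mapP[x /sG xG ->]|/tG].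
  rewrite big_cat big_map mulr_sumr /=; congr (_ + _).
  by apply: eq_bigr => x _; rewrite mulrA.
Qed.

HB.instance Definition _ K p :=
  isIdealr.Build {mpoly R[n]} (affine_ideal K p) (affine_idealr_closed K p).

(* A(K) = R[K]/(theta_1, ..., theta_d, c), as the quotient of the polynomial
   ring by the sum of the face ideal I_K and (theta_1, ..., theta_d, c). *)
Definition affine_ring K p : comNzRingType :=
  {ideal_quot (affine_ideal K p : idealr {mpoly R[n]})}.

Definition affine_proj K p (f : {mpoly R[n]}) : affine_ring K p :=
  \pi_({ideal_quot (affine_ideal K p : idealr {mpoly R[n]})}) f.

End Ring.

(* A quotient ring N of the polynomial ring is given by its projection. *)
Section Level.
Variables (R : realType) (n : nat) (N : comNzRingType).
Variable proj : {mpoly R[n]} -> N.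

Definition graded_piece (k : nat) (y : N) : Prop :=
  exists f : {mpoly R[n]}, f \is k.-homog /\ y = proj f.

Definition socle (y : N) : Prop := forall v : 'I_n, proj 'X_v * y = 0.

(* N_s <> 0 and N_k = 0 for k > s; such an s exists iff N is Artinian. *)
Definition top_degree (s : nat) : Prop :=
  (exists y, graded_piece s y /\ y <> 0)
  /\ forall k, (s < k)%N -> forall y, graded_piece k y -> y = 0.

(* Levelness is only meaningful when N is Artinian.  As s is quantified
   universally, [~ level] entails that N is Artinian. *)
Definition level : Prop :=
  forall s, top_degree s -> forall y, socle y <-> graded_piece s y.

End Level.

(** * Affine stresses *)

Section Stress.
Variables (R : realType) (n d : nat).
Implicit Types (p : 'I_n -> 'rV[R]_d) (K : complex n).

Definition pdiff (mu f : {mpoly R[n]}) : {mpoly R[n]} :=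
  \sum_(m <- msupp mu) mu@_m *: mderivm m f.

Definition affine_stress K p (k : nat) (l : {mpoly R[n]}) : Prop :=
  [/\ l \is k.-homog,
      forall m, m \in msupp l -> [set v | m v != 0%N] \in faces K,
      forall j : 'I_d, pdiff (theta p j) l = 0
    & pdiff (csum R n) l = 0 ].

End Stress.

(* Main.v *)
(* The sphere is the join of the boundaries of three simplices, on blocks V1, V2,
   V3 with u, u and 3 vertices; it bounds the free sum of the simplices.  Modulo
   the d + 1 linear forms only two variables t, s survive, x_v becoming the linear
   form L_v = A_v t + B_v s, where (A_v, B_v) is a Gale dual of p.  So A(K) is
   R[s, t] / (f1, f2, f3) with f_i the product of the L_v over V_i, of degrees
   u, u, 3.  In degrees u - 1 and u the quotient by f3 has dimension 3, so A(K)_u is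
   not zero, and if f1, f2 are independent modulo f3 it is a line; then some nonzero
   element of the 3-dimensional A(K)_(u-1) is killed by both s and t.  It is a socle
   element below the top degree.  Dually, it yields a stress of degree u - 1 that
   is not a derivative of one of degree u.

   Independence holds because f1 / f2 is a product of u Moebius maps L_v / L_w that
   are monotone in the same direction between roots of f3.  Written as a divided
   difference at two roots, this is the nonvanishing of a polynomial in the brackets
   [v w] = A_v B_w - B_v A_w: for natural p all of its terms have the same sign,
   and since it is not identically zero it does not vanish at a generic p. *)
Require Import Defs.
From HB Require Import structures.
From mathcomp Require Import all_boot all_order all_algebra.
From mathcomp Require Import boolp reals.
From mathcomp.multinomials Require Import ssrcomplements.
From mathcomp Require Import mpoly zify ring.

Set Implicit Arguments.
Unset Strict Implicit.
Unset Printing Implicit Defensive.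

Import Order.TTheory GRing.Theory Num.Theory.
Local Open Scope ring_scope.

(** * Homology of joins of simplex boundaries *)

(** The vertex count d + 3 leaves exactly two variables, and the block of size 3 makes the quotient
    by f3 three-dimensional in every degree from 2 on; this is where u - 1 >= 2 enters. The obstacle
    is that roots of f3 may coincide: in the free sum built below all Gale vectors of a block are
    equal, so the values of f1 and f2 at two roots always have determinant zero. Dividing that
    determinant by the bracket of the two roots repairs this; a telescoping sum gives the quotient
    without division, hence also for a double root. The Gale dual is likewise an adjugate and not an
    inverse, so that one formula makes sense over every commutative ring and can be specialised both
    at the free sum and at a generic p. Refuting levelness also requires a top degree to exist; it
    does because f1 and f2 have no common root. As for stresses, those of degree k correspond to
    linear functionals on A(K)_k. The derivative of omega by mu, paired with a socle element y, is
    omega paired with mu y = 0, so a functional that is nonzero at y is no derivative. *)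

Section Chains.
Variable n : nat.
Implicit Types (K : {set {set 'I_n}}) (s t : {set 'I_n}) (v w : 'I_n).

Local Notation N := #|{: {set 'I_n}}|.

Definition chain s : 'rV['F_2]_N := delta_mx 0 (enum_rank s).

Lemma subset_of_rank s : subset_of (enum_rank s) = s.
Proof. exact: enum_rankK. Qed.

Lemma rank_subset_of (a : 'I_N) : enum_rank (subset_of a) = a.
Proof. exact: enum_valK. Qed.

Lemma chain_sum (c : 'rV['F_2]_N) : c = \sum_s c 0 (enum_rank s) *: chain s.
Proof.
rewrite {1}[c]row_sum_delta (reindex (enum_rank : {set 'I_n} -> 'I_N)) //=.
exact: (onW_bij _ (enum_rank_bij _)).
Qed.

Lemma chain_coef s t : chain s 0 (enum_rank t) = (s == t)%:R.
Proof. by rewrite mxE eqxx (inj_eq enum_rank_inj) eq_sym. Qed.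

Lemma eq_on_chains m (M M' : 'M['F_2]_(N, m)) :
  (forall s, chain s *m M = chain s *m M') -> M = M'.
Proof.
move=> eqM; apply/row_matrixP => a.
by rewrite !rowE -(rank_subset_of a) eqM.
Qed.

Lemma addFF m (c : 'rV['F_2]_m) : c + c = 0.
Proof.
by apply/matrixP=> i j; rewrite !mxE addrr_pchar2 //; exact: pchar_Fp.
Qed.

Lemma sub_chainsP K k (c : 'rV['F_2]_N) :
  reflect (forall s, c 0 (enum_rank s) != 0 -> (s \in K) && (#|s| == k))
          (c <= chains K k)%MS.
Proof.
have mulE (x : 'rV['F_2]_N) s : (x *m chains K k) 0 (enum_rank s) =
    x 0 (enum_rank s) * ((s \in K) && (#|s| == k))%:R.
  rewrite mxE (bigD1 (enum_rank s)) //= big1 => [|a ne].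
    by rewrite addr0 mxE eqxx subset_of_rank.
  by rewrite mxE (negPf ne) mulr0.
apply: (iffP idP) => [/submxP[x ->] s|h].
  by rewrite mulE; case: (_ && _); rewrite // mulr0 eqxx.
apply/submxP; exists c; apply/matrixP=> i a; rewrite ord1.
rewrite -(rank_subset_of a) mulE.
have [->|/h ->] := eqVneq (c 0 (enum_rank (subset_of a))) 0; first by rewrite mul0r.
by rewrite mulr1.
Qed.

Lemma chain_in K k s : s \in K -> #|s| = k -> (chain s <= chains K k)%MS.
Proof.
move=> sK <-; apply/sub_chainsP => t; rewrite chain_coef.
by have [<-|_] := eqVneq s t; [rewrite sK eqxx | rewrite eqxx].
Qed.

Lemma chains_ind K k m (M : 'M['F_2]_(N, m)) p (B : 'M['F_2]_(p, m)) (c : 'rV_N) :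
  (forall s, s \in K -> #|s| = k -> (chain s *m M <= B)%MS) ->
  (c <= chains K k)%MS -> (c *m M <= B)%MS.
Proof.
move=> h /sub_chainsP cK; rewrite [c]chain_sum mulmx_suml summx_sub // => s _.
rewrite -scalemxAl; have [->|/cK/andP[sK /eqP ks]] := eqVneq (c 0 (enum_rank s)) 0.
  by rewrite scale0r sub0mx.
exact/scalemx_sub/h.
Qed.

Lemma chain_boundary s :
  chain s *m boundary n = \sum_(x in s) chain (s :\ x).
Proof.
apply/matrixP=> i a; rewrite ord1 summxE -(rank_subset_of a) -rowE !mxE !subset_of_rank.
set t := subset_of a; under eq_bigr do rewrite chain_coef.
have [|nts] := boolP (_ && _).
  case/andP=> ts /eqP cs; have [x xs e] : exists2 x, x \in s & t = s :\ x.
    have : #|s :\: t| = 1%N by rewrite cardsD (setIidPr ts) cs subSnn.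
    move/eqP/cards1P=> [x e]; have : x \in s :\: t by rewrite e set11.
    rewrite inE => /andP[xt xs]; exists x => //.
    by rewrite -e setDDr setDv set0U (setIidPr ts).
  rewrite (bigD1 x) //= e eqxx big1 ?addr0 // => y /andP[ys ne].
  case: eqP => // /setP/(_ x).
  by rewrite !inE eqxx xs (eq_sym x) ne.
rewrite big1 // => x xs; case: eqP => // e; case/negP: nts.
by rewrite -e subsetDl (cardsD1 x s) xs add1n eqxx.
Qed.

Definition unlink_mx v : 'M['F_2]_N :=
  \matrix_(a, b) ((v \in subset_of a) && (subset_of b == subset_of a :\ v))%:R.

Definition cone_mx w : 'M['F_2]_N :=
  \matrix_(a, b) ((w \notin subset_of a) && (subset_of b == w |: subset_of a))%:R.

Lemma chain_unlink v s :
  chain s *m unlink_mx v = if v \in s then chain (s :\ v) else 0.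
Proof.
apply/matrixP=> i a; rewrite ord1 -rowE !mxE subset_of_rank.
case: ifP => _ /=; last by rewrite mxE.
by rewrite -{2}(rank_subset_of a) chain_coef eq_sym.
Qed.

Lemma chain_cone w s :
  chain s *m cone_mx w = if w \in s then 0 else chain (w |: s).
Proof.
apply/matrixP=> i a; rewrite ord1 -rowE !mxE subset_of_rank.
case: ifP => _ /=; first by rewrite mxE.
by rewrite -{2}(rank_subset_of a) chain_coef eq_sym.
Qed.

Lemma setD1C s v w : s :\ v :\ w = s :\ w :\ v.
Proof. by apply/setP=> x; rewrite !inE andbCA. Qed.

Lemma boundary_unlink v : boundary n *m unlink_mx v = unlink_mx v *m boundary n.
Proof.
apply: eq_on_chains => s; rewrite !mulmxA chain_boundary chain_unlink mulmx_suml.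
case: ifP => vs; last first.
  by rewrite mul0mx big1 // => x _; rewrite chain_unlink !inE vs andbF.
rewrite (bigD1 v) //= chain_unlink !inE eqxx add0r chain_boundary.
apply: eq_big => [x|x /andP[_ ne]]; first by rewrite !inE andbC.
by rewrite chain_unlink !inE vs eq_sym ne setD1C.
Qed.

(** Coning from [w] is a contracting homotopy of the full simplex, without signs in characteristic
    2. It yields both that the boundary squares to zero and that cones are acyclic. *)
Lemma boundary_cone w :
  boundary n *m cone_mx w + cone_mx w *m boundary n = 1%:M.
Proof.
apply: eq_on_chains => s; rewrite mulmx1 mulmxDr !mulmxA chain_boundary chain_cone.
rewrite mulmx_suml; case: ifP => ws.
  rewrite mul0mx addr0 (bigD1 w) //= chain_cone !inE eqxx /= setD1K //.
  rewrite big1 ?addr0 // => x /andP[_ ne].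
  by rewrite chain_cone !inE ws eq_sym ne.
rewrite chain_boundary [X in _ + X](bigD1 w) ?setU11 //= setU1K ?ws //.
rewrite addrCA [X in _ + X](_ : _ = 0) ?addr0 //.
rewrite [X in _ + X](eq_big (mem s) (fun x => chain (w |: (s :\ x)))).
- rewrite -big_split big1 //= => x xs; rewrite chain_cone !inE ws andbF.
  exact: addFF.
- by move=> x; rewrite !inE; case: eqP => [->|_]; rewrite ?ws ?andbT.
- move=> x /andP[_ ne]; congr chain; apply/setP=> y; rewrite !inE.
  by have [->|] := eqVneq y x; rewrite //= (negPf ne).
Qed.

Lemma boundaryK : boundary n *m boundary n = 0.
Proof.
apply: eq_on_chains => s; rewrite mulmx0.
elim: {s}_.+1 {-2}s (ltnSn #|s|) => // k IH s; rewrite ltnS => sk.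
have [->|[w ws]] := set_0Vmem s.
  by rewrite mulmxA chain_boundary big_set0 mul0mx.
have e : chain s = chain (s :\ w) *m cone_mx w.
  by rewrite chain_cone !inE eqxx /= setD1K.
have IHw : chain (s :\ w) *m boundary n *m boundary n = 0.
  by rewrite -mulmxA IH //; apply: leq_trans sk; rewrite (cardsD1 w s) ws.
have hom (c : 'rV_N) : c *m cone_mx w *m boundary n =
    c + c *m boundary n *m cone_mx w.
  rewrite -[X in X + _]mulmx1 -(boundary_cone w) mulmxDr !mulmxA.
  by rewrite addrAC addFF add0r.
rewrite e mulmxA hom mulmxDl hom IHw mul0mx addr0; exact: addFF.
Qed.

Lemma cycleP K k (c : 'rV_N) :
  (c <= cycles K k)%MS = (c <= chains K k)%MS && (c *m boundary n == 0).
Proof. by rewrite sub_capmx; congr andb; apply/sub_kermxP/eqP. Qed.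

(* The long exact sequence of the pair (K, deletion of v), in ranks: the deletion
   is a cone with apex w, hence acyclic. *)
Section ConeDeletion.
Variables (K : {set {set 'I_n}}) (v w : 'I_n).
Hypothesis subK : forall s t, t \subset s -> s \in K -> t \in K.
Hypothesis vK : [set v] \in K.
Hypothesis nvw : w != v.
Hypothesis coneK : forall t, t \in K -> v \notin t -> w |: t \in K.

Let L := [set t in K | (v \notin t) && (v |: t \in K)].
Let D := [set t in K | v \notin t].

Lemma chains_unlink k (c : 'rV_N) :
  (c <= chains K k.+1)%MS -> (c *m unlink_mx v <= chains L k)%MS.
Proof.
apply: chains_ind => s sK sk; rewrite chain_unlink; case: ifP => vs; last exact: sub0mx.
apply: chain_in; last by move: sk; rewrite (cardsD1 v s) vs => -[].
by rewrite !inE eqxx /= setD1K // sK (subK (subsetDl _ _) sK).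
Qed.

Lemma link_chains_cone k (c : 'rV_N) :
  (c <= chains L k)%MS -> (c *m cone_mx v <= chains K k.+1)%MS.
Proof.
apply: chains_ind => s; rewrite inE => /and3P[sK vs vsK] sk.
by rewrite chain_cone (negPf vs); apply: chain_in; rewrite // cardsU1 vs sk.
Qed.

Lemma del_chains_cone k (c : 'rV_N) :
  (c <= chains D k)%MS -> (c *m cone_mx w <= chains D k.+1)%MS.
Proof.
apply: chains_ind => s; rewrite inE => /andP[sK vs] sk.
rewrite chain_cone; case: ifP => ws; first exact: sub0mx.
apply: chain_in; last by rewrite cardsU1 ws sk.
by rewrite !inE coneK // negb_or vs eq_sym nvw.
Qed.

Lemma chains_sub (K1 K2 : {set {set 'I_n}}) k (c : 'rV_N) :
  K1 \subset K2 -> (c <= chains K1 k)%MS -> (c <= chains K2 k)%MS.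
Proof.
by move=> /subsetP s12 /sub_chainsP h; apply/sub_chainsP => s /h /andP[/s12 -> ->].
Qed.

Lemma unlink_coneK k (c : 'rV_N) :
  (c <= chains L k)%MS -> c *m cone_mx v *m unlink_mx v = c.
Proof.
move=> /sub_chainsP cL; rewrite [c]chain_sum !mulmx_suml; apply: eq_bigr => s _.
have [->|/cL] := eqVneq (c 0 (enum_rank s)) 0; first by rewrite !scale0r !mul0mx.
rewrite inE => /andP[/and3P[_ vs _] _].
by rewrite -!scalemxAl chain_cone (negPf vs) chain_unlink setU11 setU1K.
Qed.

Lemma unlink_eq0 k (c : 'rV_N) : (c <= chains K k)%MS ->
  (c *m unlink_mx v == 0) = (c <= chains D k)%MS.
Proof.
move=> /sub_chainsP cK; apply/eqP/sub_chainsP => [c0 s cs|cD]; last first.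
  rewrite [c]chain_sum mulmx_suml big1 // => s _; rewrite -scalemxAl chain_unlink.
  have [->|/cD] := eqVneq (c 0 (enum_rank s)) 0; first by rewrite scale0r.
  by rewrite inE => /andP[/andP[_ /negPf->] _]; rewrite scaler0.
have /andP[sK ->] := cK s cs; rewrite inE sK andbT /=.
apply/negP => vs; case/negP: cs; apply/eqP.
have /matrixP/(_ 0 (enum_rank (s :\ v))) := c0.
rewrite [c in LHS]chain_sum mulmx_suml summxE (bigD1 s) //= [in RHS]mxE.
rewrite -scalemxAl chain_unlink vs mxE chain_coef eqxx mulr1 big1 ?addr0 // => t ts.
rewrite -scalemxAl chain_unlink mxE; case: ifP => vt; last by rewrite mxE mulr0.
rewrite chain_coef; case: eqP => [e|]; last by rewrite mulr0.
by case/eqP: ts; rewrite -(setD1K vt) e setD1K.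
Qed.

Lemma del_cycle_boundary k (c : 'rV_N) :
  (c <= chains D k)%MS -> c *m boundary n = 0 -> c = c *m cone_mx w *m boundary n.
Proof.
move=> cD c0; rewrite -[LHS]mulmx1 -(boundary_cone w) mulmxDr !mulmxA c0.
by rewrite mul0mx add0r.
Qed.

Lemma DK : D \subset K.
Proof. by apply/subsetP => s; rewrite inE => /andP[]. Qed.

Lemma LD : L \subset D.
Proof. by apply/subsetP => s; rewrite !inE => /and3P[-> ->]. Qed.

(** Surjectivity comes from suspension: a cycle [c] of the link lifts to its cone from [v] plus its
    cone from [w]. The second cone lies in the deletion, and the two copies of [c] in the boundary
    cancel. *)
Lemma cycles_unlink k : (cycles K k.+1 *m unlink_mx v :=: cycles L k)%MS.
Proof.
apply/eqmxP/rV_eqP => c; apply/idP/idP => [/submxP[x ->]|].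
  rewrite mulmxA; have : (x *m cycles K k.+1 <= cycles K k.+1)%MS by exact: submxMl.
  set y := x *m _; rewrite !cycleP => /andP[yK /eqP y0].
  by rewrite chains_unlink //= -mulmxA -boundary_unlink mulmxA y0 mul0mx.
rewrite cycleP => /andP[cL /eqP c0].
have cD := chains_sub LD cL.
pose y := c *m cone_mx v + c *m cone_mx w.
have yE : y *m unlink_mx v = c.
  rewrite mulmxDl (unlink_coneK cL); apply/eqP; rewrite addrC -subr_eq0 addrK.
  by rewrite (@unlink_eq0 k.+1) ?(chains_sub DK) ?del_chains_cone.
rewrite -yE submxMr // cycleP addmx_sub ?link_chains_cone //=; last first.
  by rewrite (chains_sub DK) ?del_chains_cone.
rewrite mulmxDl -(del_cycle_boundary cD c0).
have hv : c = c *m cone_mx v *m boundary n.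
  by rewrite -[LHS]mulmx1 -(boundary_cone v) mulmxDr !mulmxA c0 mul0mx add0r.
by rewrite -hv addFF.
Qed.

Lemma cycles_ker k : (cycles K k :&: kermx (unlink_mx v) :=: cycles D k)%MS.
Proof.
apply/eqmxP/rV_eqP => c; rewrite sub_capmx !cycleP.
have -> : (c <= kermx (unlink_mx v))%MS = (c *m unlink_mx v == 0).
  by apply/sub_kermxP/eqP.
rewrite andbAC; congr andb; apply/andP/idP => [[cK]|cD].
  by rewrite (unlink_eq0 cK).
by rewrite (unlink_eq0 (chains_sub DK cD)) (chains_sub DK cD).
Qed.

Lemma boundaries_unlink k : (boundaries K k.+1 *m unlink_mx v :=: boundaries L k)%MS.
Proof.
rewrite /boundaries -mulmxA boundary_unlink mulmxA; apply: eqmxMr.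
apply/eqmxP/rV_eqP => c; apply/idP/idP => [/submxP[x ->]|cL].
  by rewrite mulmxA chains_unlink ?submxMl.
by rewrite -(unlink_coneK cL) submxMr // link_chains_cone.
Qed.

(** A boundary supported on the deletion is a cycle there; conversely a cycle of the deletion bounds
    its own cone from [w]. *)
Lemma boundaries_ker k :
  (boundaries K k.+1 :&: kermx (unlink_mx v) :=: cycles D k.+1)%MS.
Proof.
apply/eqmxP/rV_eqP => c; rewrite sub_capmx cycleP.
have -> : (c <= kermx (unlink_mx v))%MS = (c *m unlink_mx v == 0).
  by apply/sub_kermxP/eqP.
apply/andP/andP => [[/submxP[x ->]]|[cD /eqP c0]]; last first.
  rewrite (unlink_eq0 (chains_sub DK cD)) cD; split=> //.
  rewrite (del_cycle_boundary cD c0) submxMr // (chains_sub DK) //.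
  exact: del_chains_cone.
rewrite /boundaries mulmxA -[_ *m boundary n *m boundary n]mulmxA boundaryK mulmx0 eqxx.
set y := x *m _; have yK : (y <= chains K k.+2)%MS by exact: submxMl.
rewrite (@unlink_eq0 k.+1) //; move: yK; apply: chains_ind => s sK sk.
rewrite chain_boundary summx_sub // => z zs; apply: chain_in.
  exact: subK (subsetDl _ _) sK.
by move: sk; rewrite (cardsD1 z s) zs => -[].
Qed.

(** Unlinking [v] maps the cycles and the boundaries of [K] onto those of the link, with the same
    kernel in both cases, so the difference of ranks is preserved. *)
Lemma betti_cone_deletion k : betti K k.+1 = betti L k.
Proof.
rewrite /betti -(mxrank_mul_ker (cycles K k.+1) (unlink_mx v)).
rewrite -(mxrank_mul_ker (boundaries K k.+1) (unlink_mx v)).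
rewrite (cycles_unlink k).1 (cycles_ker k.+1).1 (boundaries_unlink k).1.
by rewrite (boundaries_ker k).1 subnDr.
Qed.

Lemma betti_cone_deletion0 : betti K 0 = 0%N.
Proof.
apply/eqP; rewrite subn_eq0 mxrankS //; apply/rV_subP => c.
rewrite cycleP => /andP[/sub_chainsP cK _].
rewrite [c]chain_sum summx_sub // => s _.
have [->|/cK/andP[_]] := eqVneq (c 0 (enum_rank s)) 0; first by rewrite scale0r sub0mx.
rewrite cards_eq0 => /eqP ->; apply: scalemx_sub.
have -> : chain set0 = chain [set v] *m boundary n.
  by rewrite chain_boundary big_set1 setDv.
by rewrite submxMr // chain_in ?cards1.
Qed.

End ConeDeletion.

Lemma betti_void k : betti [set set0 : {set 'I_n}] k = (k == 0)%N.
Proof.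
have z m : (0 < m)%N -> chains [set set0 : {set 'I_n}] m = 0.
  move=> m0; apply/matrixP=> a b; rewrite !mxE inE.
  case: eqP => //= _; case: eqP => //= ->.
  by rewrite cards0; case: eqP m0 => // <-.
rewrite /betti /boundaries z // mul0mx mxrank0 subn0.
case: k => [|k]; last by rewrite /cycles z // cap0mx mxrank0.
have -> : (cycles [set set0 : {set 'I_n}] 0 :=: chain set0)%MS.
  apply/eqmxP/rV_eqP => c; apply/idP/idP.
    rewrite cycleP => /andP[/sub_chainsP cK _].
    rewrite [c]chain_sum summx_sub // => s _.
    have [->|/cK/andP[]] := eqVneq (c 0 (enum_rank s)) 0; first by rewrite scale0r sub0mx.
    by rewrite inE => /eqP -> _; apply: scalemx_sub.
  move/submx_trans; apply; rewrite cycleP chain_in ?inE ?cards0 //=.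
  by rewrite chain_boundary big_set0.
by rewrite mxrank_delta.
Qed.

End Chains.

(** * Joins of simplex boundaries are homology spheres *)

Section SimplexJoin.
Variables (n r : nat) (col : 'I_n -> 'I_r).
Implicit Types (s t U : {set 'I_n}) (v w : 'I_n).

Definition block (i : 'I_r) : {set 'I_n} := [set v | col v == i].

(** The join of the boundaries of the simplices on the sets [block i :&: U]. The parameter [U]
    closes the family under links: the link of a face [s] of the whole join is [avoid (~: s)]. *)
Definition avoid U : {set {set 'I_n}} :=
  [set t : {set 'I_n} | (t \subset U) && [forall i, ~~ (block i :&: U \subset t)]].

Lemma avoidP U t :
  reflect (t \subset U /\ forall i, ~~ (block i :&: U \subset t)) (t \in avoid U).
Proof. by rewrite inE; apply: (iffP andP) => -[? /forallP]. Qed.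

Lemma avoid_sub U s t : t \subset s -> s \in avoid U -> t \in avoid U.
Proof.
move=> ts /avoidP[sU h]; apply/avoidP; split; first exact: subset_trans sU.
by move=> i; apply: contra (h i) => /subset_trans; apply.
Qed.

(** Adding [w] could only complete the block of [w], which is also the block of the absent vertex
    [v]. *)
Lemma avoid_deletion_cone U v w : w \in U -> col w = col v -> v \in U ->
  w != v -> forall t, t \in avoid U -> v \notin t -> w |: t \in avoid U.
Proof.
move=> wU cwv vU nwv t /avoidP[tU h] vt; apply/avoidP; split.
  by rewrite subUset sub1set wU.
move=> i; apply: contra (h i) => /subsetP hi; apply/subsetP => x xi.
have := hi x xi; rewrite !inE => /predU1P[xw|//]; subst x.
have /hi : v \in block i :&: U.
  by move: xi; rewrite !inE cwv vU => /andP[->].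
by rewrite !inE eq_sym (negPf nwv) (negPf vt).
Qed.

Lemma avoid_link U v : v \in U ->
  [set t in avoid U | (v \notin t) && (v |: t \in avoid U)] = avoid (U :\ v).
Proof.
move=> vU; apply/setP=> t; rewrite inE; apply/and3P/avoidP.
  case=> /avoidP[tU _] vt /avoidP[_ h]; split; first by rewrite subsetD1 tU.
  move=> i; apply: contra (h i) => /subsetP hi; apply/subsetP => x.
  rewrite !inE => /andP[xi xU]; have [//|xv] := eqVneq x v.
  by apply: hi; rewrite !inE xi xv.
rewrite subsetD1 => -[/andP[tU vt] h].
have vtU : v |: t \in avoid U.
  apply/avoidP; split; first by rewrite subUset sub1set vU.
  move=> i; apply: contra (h i) => /subsetP hi; apply/subsetP => x.
  rewrite !inE => /and3P[xi xv xU].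
  by have := hi x; rewrite !inE xi xU (negPf xv) /=; apply.
by split=> //; apply: avoid_sub vtU; exact: subsetUr.
Qed.

(** Induction on the size of [U]. If a block keeps two vertices [v] and [w], deleting [v] leaves a
    cone with apex [w], so passing to the link of [v] lowers the degree by one. If every block is a
    single vertex, only the empty face is left, the sphere of dimension -1. *)
Lemma betti_avoid U k : (forall i, block i :&: U != set0) ->
  betti (avoid U) k = (k + r == #|U|)%N.
Proof.
elim: {U}_.+1 {-2}U (ltnSn #|U|) k => // m IH U; rewrite ltnS => Um k U0.
have [[i ci]|h1] := pselect (exists i, 1 < #|block i :&: U|)%N.
  have /card_gt1P[v [w [vi wi nvw]]] := ci.
  have nwv : w != v by rewrite eq_sym.
  move: (vi) (wi); rewrite !inE => /andP[/eqP cv vU] /andP[/eqP cw wU].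
  have cone := avoid_deletion_cone wU (etrans cw (esym cv)) vU nwv.
  have sub := @avoid_sub U.
  have cU : #|U| = #|U :\ v|.+1 by rewrite (cardsD1 v) vU.
  have Uv0 j : block j :&: (U :\ v) != set0.
    have [->|ne] := eqVneq j i.
      by apply/set0Pn; exists w; rewrite !inE cw eqxx nwv wU.
    have /set0Pn[x] := U0 j; rewrite inE => /andP[xj xU].
    apply/set0Pn; exists x; rewrite in_setI xj !inE xU andbT /=.
    by apply: contraNneq ne => e; move: xj; rewrite inE e cv eq_sym.
  have vK : [set v] \in avoid U.
    suff : set0 \in avoid (U :\ v).
      by rewrite -avoid_link // inE setU0 => /and3P[].
    by apply/avoidP; split=> [|j]; [exact: sub0set | rewrite subset0].
  case: k => [|k].
    (* In degree 0 the claim is that [r] differs from the size of [U]: the set [U :\ v] still meets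
       all [r] blocks. *)
    rewrite (betti_cone_deletion0 vK) cU.
    case: eqP => //= e; have : (r <= #|U :\ v|)%N.
      rewrite -[r in (r <= _)%N]card_ord; apply: (@leq_trans #|col @: (U :\ v)|); last first.
        exact: leq_imset_card.
      rewrite -cardsT; apply/subset_leq_card/subsetP => j _.
      have /set0Pn[x] := Uv0 j; rewrite !inE => /andP[/eqP <- xU].
      by apply: imset_f; rewrite !inE.
    by rewrite -ltnS -e ltnn.
  rewrite (betti_cone_deletion sub nwv cone) avoid_link // IH // -?cU //.
  by rewrite cU addSn eqSS.
have c1 i : #|block i :&: U| = 1%N.
  apply/eqP; rewrite eqn_leq card_gt0 U0 andbT leqNgt; apply/negP => ci.
  by apply: h1; exists i.
have -> : avoid U = [set set0].
  apply/setP=> t; rewrite in_set1; apply/avoidP/eqP => [[tU h]|->]; last first.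
    by split; [exact: sub0set | move=> i; rewrite subset0].
  apply/eqP; apply: contraT => /set0Pn[x xt].
  have := h (col x); have /eqP/cards1P[y e] := c1 (col x); rewrite e.
  have : x \in block (col x) :&: U by rewrite !inE eqxx (subsetP tU).
  by rewrite e inE => /eqP <-; rewrite sub1set xt.
rewrite betti_void; suff -> : #|U| = r by rewrite -{2}[r]add0n eqn_add2r.
have <- : #|col @: U| = #|U|.
  apply: card_in_imset => x y xU yU e.
  have /eqP/cards1P[z ez] := c1 (col x).
  have : x \in block (col x) :&: U by rewrite !inE eqxx.
  have : y \in block (col x) :&: U by rewrite !inE e eqxx.
  by rewrite ez !inE => /eqP -> /eqP.
rewrite -[RHS]card_ord -cardsT; congr #|pred_of_set _|; apply/setP => j.
rewrite in_setT; have /set0Pn[x] := U0 j; rewrite !inE => /andP[/eqP <- xU].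
exact: imset_f.
Qed.

Hypothesis block_gt1 : forall i, (1 < #|block i|)%N.

Lemma simplex_join0 : set0 \in avoid setT.
Proof.
apply/avoidP; split=> [|i]; first exact: sub0set.
by rewrite setIT subset0 -card_gt0 ltnW.
Qed.

Lemma simplex_join1 v : [set v] \in avoid setT.
Proof.
apply/avoidP; split=> [|i]; first exact: subsetT.
by rewrite setIT; apply/negP => /subset_leq_card; rewrite cards1 leqNgt block_gt1.
Qed.

Lemma simplex_joinS s t : t \subset s -> s \in avoid setT -> t \in avoid setT.
Proof. exact: avoid_sub. Qed.

Definition simplex_join : complex n :=
  Complex simplex_join0 simplex_join1 simplex_joinS.

Lemma simplex_joinP s :
  reflect (forall i, ~~ (block i \subset s)) (s \in faces simplex_join).
Proof.
apply: (iffP (avoidP _ _)) => [[_ h] i|h]; first by have := h i; rewrite setIT.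
by split=> [|i]; [exact: subsetT | rewrite setIT].
Qed.

Lemma simplex_join_link s : s \in faces simplex_join ->
  link simplex_join s = avoid (~: s).
Proof.
move=> sK; apply/setP=> t; rewrite inE.
have e i : (block i \subset t :|: s) = (block i :&: ~: s \subset t).
  by rewrite -setDE subDset setUC.
apply/and3P/avoidP => [[_ /simplex_joinP h ts]|[ts h]].
  by split=> [|i]; [rewrite -disjoints_subset | rewrite -e].
have tsK : t :|: s \in faces simplex_join by apply/simplex_joinP => i; rewrite e.
by split; [exact: complexS (subsetUl _ _) tsK | | rewrite disjoints_subset].
Qed.

Lemma simplex_join_sphere d : (d + r = n)%N -> homology_sphere d simplex_join.
Proof.
move=> dn; split=> s sK => [smax|k]; last first.
  rewrite simplex_join_link // betti_avoid => [|i]; last first.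
    by rewrite -setDE setD_eq0; have /simplex_joinP := sK.
  have := cardsC s; rewrite card_ord => e.
  by congr nat_of_bool; apply/idP/idP => /eqP h; apply/eqP; lia.
have /simplex_joinP h := sK.
(* Pick one omitted vertex in each block: the complement of these is a face containing [s], so a
   maximal [s] equals it and omits exactly [r] vertices. *)
have hb i : exists x, x \in block i :\: s by apply/set0Pn; rewrite setD_eq0.
pose b i := xchoose (hb i).
have bP i : b i \in block i :\: s := xchooseP (hb i).
have bi : injective b.
  move=> i j e; have := bP i; have := bP j.
  by rewrite e !inE => /andP[_ /eqP ej] /andP[_ /eqP ei]; rewrite -[LHS]ei.
have eC : ~: [set b i | i : 'I_r] = s.
  apply: smax.
    apply/simplex_joinP => i; apply/subsetPn; exists (b i).
      by have := bP i; rewrite inE => /andP[].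
    by rewrite inE negbK imset_f.
  apply/subsetP=> x xs; rewrite inE; apply/imsetP => -[i _ e].
  by have := bP i; rewrite -e inE xs.
have := cardsC s; rewrite card_ord -{2}eC setCK card_imset // card_ord.
by move: dn; lia.
Qed.

Lemma simplex_join_missing s : missing_face simplex_join s <-> exists i, s = block i.
Proof.
split=> [[sK sP]|[i ->]].
  have [i bs] : exists i, block i \subset s.
    apply/existsP; rewrite -[[exists _, _]]negbK negb_exists.
    by apply: contra sK => /forallP h; apply/simplex_joinP.
  exists i; apply/eqP; rewrite eqEsubset bs andbT; apply/negPn/negP => h.
  have /sP/simplex_joinP/(_ i)/negP[] : block i \proper s by rewrite properE bs.
  exact: subxx.
split=> [|t /properP[tb [x xb xt]]].
  by apply/simplex_joinP => /(_ i); rewrite subxx.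
apply/simplex_joinP => j; apply/negP => /subsetP jt.
have /card_gt0P[y yj] := ltnW (block_gt1 j).
have := subsetP tb _ (jt _ yj); move: yj; rewrite !inE => /eqP -> /eqP e; subst j.
by case/negP: xt; apply: jt.
Qed.

Lemma simplex_join_class d j : (d + r = n)%N -> (forall i, #|block i| <= j.+1)%N ->
  sphere_class j d simplex_join.
Proof.
move=> dn bj; split; first exact: simplex_join_sphere.
by move=> s /simplex_join_missing[i ->]; move: (bj i); case: #|_|.
Qed.

End SimplexJoin.

(** * Free sums of simplices *)

Section Conv.
Variables (R : realType) (n d : nat) (p : 'I_n -> 'rV[R]_d).

Lemma dot_sum (w : 'I_n -> R) (a : 'cV[R]_d) :
  ((\sum_v w v *: p v) *m a) 0 0 = \sum_v w v * (p v *m a) 0 0.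
Proof.
rewrite mulmx_suml summxE; apply: eq_bigr => v _.
by rewrite -scalemxAl mxE.
Qed.

Lemma conv_vertex v : conv p (p v).
Proof.
exists (fun x => (x == v)%:R); split=> [x||]; first exact: ler0n.
  by rewrite (bigD1 v) //= eqxx big1 ?addr0 // => x /negPf ->.
rewrite (bigD1 v) //= eqxx scale1r big1 ?addr0 // => x /negPf ->.
by rewrite scale0r.
Qed.

End Conv.

Section FreeSum.
Variables (R : realType) (n r d : nat) (col : 'I_n -> 'I_r).
Variable p : 'I_n -> 'rV[R]_d.
Hypothesis r_gt0 : (0 < r)%N.
Hypothesis block_gt2 : forall i, (2 < #|block col i|)%N.
Hypothesis sum_block : forall i, \sum_(v in block col i) p v = 0.
Hypothesis extend : forall g : 'I_n -> R,
  (forall i, \sum_(v in block col i) g v = 0) ->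
  exists a : 'cV[R]_d, forall v, (p v *m a) 0 0 = g v.
Hypothesis span : forall x : 'rV[R]_d, exists w : 'I_n -> R, x = \sum_v w v *: p v.

Let bgt1 i : (1 < #|block col i|)%N := ltnW (block_gt2 i).
Let K := simplex_join bgt1.

(** The functional must have sum 0 on each block. It is 1 on [s], and the remaining vertices of a
    block share equally the drop needed to cancel the block sum. *)
Lemma join_functional s : s \in faces K ->
  exists a : 'cV[R]_d, forall v, (p v *m a) 0 0 <= 1 /\
    ((p v *m a) 0 0 == 1) = (v \in s).
Proof.
move=> /simplex_joinP sK.
have b0 i : (0 < #|block col i :\: s|)%N.
  by rewrite card_gt0 setD_eq0.
pose h v : R := if v \in s then 0 else
  #|block col (col v)|%:R / #|block col (col v) :\: s|%:R.
have h0 v : 0 <= h v by rewrite /h; case: ifP => // _; rewrite divr_ge0.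
have hE v : (h v == 0) = (v \in s).
  rewrite /h; case: ifP; rewrite ?eqxx // => _; apply/negbTE.
  rewrite mulf_neq0 ?invr_eq0 ?pnatr_eq0 -?lt0n //.
  exact: leq_trans (bgt1 _).
have [a ha] : exists a : 'cV[R]_d, forall v, (p v *m a) 0 0 = 1 - h v.
  apply: extend => i; rewrite sumrB (big_setID s) /= [X in _ - X](big_setID s) /=.
  rewrite [X in _ - (X + _)]big1 => [|v]; last first.
    by rewrite /h inE => /andP[_ ->].
  rewrite add0r [X in _ - X](eq_bigr (fun=> #|block col i|%:R / #|block col i :\: s|%:R)).
    rewrite !sumr_const -mulrnDr cardsID -[X in _ - X]mulr_natr.
    by rewrite divfK ?subrr // pnatr_eq0 -lt0n.
  by move=> v; rewrite !inE /h => /andP[/negPf -> /eqP ->].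
exists a => v; rewrite ha; split; first by rewrite lerBlDr lerDl.
by rewrite -hE -subr_eq0 addrAC subrr add0r oppr_eq0.

Qed.

(** The slacks of a supporting hyperplane are nonnegative and sum over a block to its size times
    [b]. A face containing a whole block forces [b = 0], then all slacks vanish and the face is the
    whole polytope. *)
Lemma face_block_free F s : proper_face (conv p) F -> face_vertices p F s ->
  s \in faces K.
Proof.
move=> [[a [b [ab Fab]]] [x [[w [w0 w1 xE]] nFx]]] Fs.
pose h v := b - (p v *m a) 0 0.
have h0 v : 0 <= h v by rewrite subr_ge0; apply/ab/conv_vertex.
have sumh i : \sum_(v in block col i) h v = #|block col i|%:R * b.
  rewrite sumrB sumr_const -[X in X - _]mulr_natl.
  suff -> : \sum_(v in block col i) (p v *m a) 0 0 = 0 by rewrite subr0.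
  by rewrite -summxE -mulmx_suml sum_block mul0mx mxE.
apply/simplex_joinP => i; apply/negP => /subsetP bs.
have b0 : b = 0.
  have /eqP := sumh i; rewrite big1 => [|v /bs /Fs /Fab[_ e]]; last first.
    by rewrite /h e subrr.
  rewrite eq_sym mulf_eq0 pnatr_eq0 -leqn0 leqNgt.
  by rewrite (leq_trans _ (bgt1 i)) //= => /eqP.
have hz v : h v = 0.
  have := sumh (col v); rewrite b0 mulr0 => /psumr_eq0P; apply => //.
  by rewrite inE.
apply: nFx; apply/Fab; split; first by exists w.
rewrite xE dot_sum -[RHS]mul1r -w1 mulr_suml; apply: eq_bigr => v _; congr (_ * _).
by apply/eqP; rewrite eq_sym -subr_eq0; apply/eqP/hz.
Qed.

(** Evaluate the relation on the functional that is 1 at [v], -1 at [x] and 0 elsewhere; it exists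
    because its block sums vanish. *)
Lemma dependence_block_constant (w : 'I_n -> R) : \sum_v w v *: p v = 0 ->
  forall v x, col v = col x -> w v = w x.
Proof.
move=> w0 v x cvx; have [->//|ne] := eqVneq v x.
have [a ha] : exists a : 'cV[R]_d, forall y, (p y *m a) 0 0 = (y == v)%:R - (y == x)%:R.
  apply: extend => i; rewrite sumrB.
  have sumd z : \sum_(y in block col i) (y == z)%:R = (z \in block col i)%:R :> R.
    rewrite big_mkcond (bigD1 z) //= eqxx big1 => [|y /negPf ->]; last by case: ifP.
    by rewrite addr0; case: ifP.
  by rewrite !sumd !inE cvx subrr.
have := congr1 (fun x : 'rV_d => (x *m a) 0 0) w0.
rewrite dot_sum mul0mx mxE; under eq_bigr do rewrite ha mulrBr.
rewrite sumrB (bigD1 v) //= [X in _ - X](bigD1 x) //= !eqxx !mulr1.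
rewrite big1 => [|y /negPf ->]; last by rewrite mulr0.
rewrite [X in _ - (_ + X)]big1 => [|y /negPf ->]; last by rewrite mulr0.
by rewrite !addr0 => /eqP; rewrite subr_eq0 => /eqP.
Qed.

Lemma free_sum_natural : natural K p.
Proof.
have inj : injective p.
  move=> v x e; apply/eqP; apply: contraT => ne.
  (* If [p v = p x], then the indicator of [v] minus that of [x] is a dependence; it cannot be
     constant on the block of [v], which has a third vertex [y]. *)
  have : (0 < #|block col (col v) :\: [set v; x]|)%N.
    rewrite cardsD subn_gt0; apply: leq_ltn_trans (block_gt2 _).
    apply: leq_trans (subset_leq_card (subsetIr _ _)) _.
    by rewrite cards2 ne.
  case/card_gt0P=> y; rewrite !inE negb_or => /andP[/andP[yv yx] /eqP cy].
  have w0 : \sum_z ((z == v)%:R - (z == x)%:R : R) *: p z = 0.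
    under eq_bigr do rewrite scalerBl.
    rewrite sumrB (bigD1 v) //= [X in _ - X](bigD1 x) //= !eqxx !scale1r e.
    rewrite big1 => [|z /negPf ->]; last by rewrite scale0r.
    rewrite [X in _ - (_ + X)]big1 => [|z /negPf ->]; last by rewrite scale0r.
    by rewrite !addr0 subrr.
  have := dependence_block_constant w0 cy.
  rewrite (negPf yv) (negPf yx) eqxx (negPf ne) !subr0 => /eqP.
  by rewrite eq_sym oner_eq0.
split.
- split=> // x; split=> [[a [b [ab xF]]]|[v ->]].
    have [[w [w0 w1 xE]] xb] := (xF x).1 erefl.
    have [v wv] : exists v, 0 < w v.
      apply/existsP; rewrite -[[exists _, _]]negbK negb_exists; apply/negP => /forallP h.
      have /eqP := w1; rewrite big1 => [|v _]; first by rewrite eq_sym oner_eq0.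
      by apply/eqP; rewrite eq_le w0 andbT leNgt h.
    exists v; apply/esym/xF; split; first exact: conv_vertex.
    have h0 y : 0 <= w y * (b - (p y *m a) 0 0).
      by rewrite mulr_ge0 // subr_ge0; apply/ab/conv_vertex.
    have /psumr_eq0P : \sum_y w y * (b - (p y *m a) 0 0) = 0.
      under eq_bigr do rewrite mulrBr.
      by rewrite sumrB -mulr_suml w1 mul1r -dot_sum -xE xb subrr.
    move=> /(_ (fun y _ => h0 y) v isT) /eqP.
    by rewrite mulf_eq0 gt_eqF //= subr_eq0 eq_sym => /eqP.
  have [a ha] := join_functional (complex1 K v).
  exists a, 1; split=> [z [w [w0 w1 ->]]|z].
    rewrite dot_sum -w1 ler_sum // => y _.
    by rewrite -[leRHS]mulr1 ler_wpM2l // (ha y).1.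
  split=> [->|[[w [w0 w1 zE]] z1]].
    by split; [exact: conv_vertex | apply/eqP; rewrite (ha v).2 inE].
  have h0 y : 0 <= w y * (1 - (p y *m a) 0 0).
    by rewrite mulr_ge0 // subr_ge0 (ha y).1.
  have /psumr_eq0P : \sum_y w y * (1 - (p y *m a) 0 0) = 0.
    under eq_bigr do rewrite mulrBr.
    by rewrite sumrB -mulr_suml w1 mul1r -dot_sum -zE z1 subrr.
  move=> /(_ (fun y _ => h0 y)) wz.
  have wv y : y != v -> w y = 0.
    move=> ne; have /eqP := wz y isT; rewrite mulf_eq0 => /orP[/eqP //|].
    by rewrite subr_eq0 eq_sym (ha y).2 inE (negPf ne).
  have e1 : w v = 1 by rewrite -w1 (bigD1 v) //= big1 ?addr0.
  rewrite zE (bigD1 v) //= e1 scale1r big1 ?addr0 // => y /wv ->.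
  by rewrite scale0r.
- move=> x; have [w ->] := span x; pose i0 := Ordinal r_gt0.
  pose m : R := #|block col i0|%:R; pose S := \sum_v w v.
  have m0 : m != 0 by rewrite pnatr_eq0 -lt0n (leq_trans _ (bgt1 _)).
  (* Adding a multiple of the zero relation on one block corrects the total weight to 1 without
     moving the point. *)
  exists (fun v => w v + (1 - S) / m * (v \in block col i0)%:R); split.
    rewrite big_split /= -mulr_sumr [X in _ * X](_ : _ = m) //; last first.
      rewrite /m -sumr_const [RHS]big_mkcond; apply: eq_bigr => v _.
      by case: (v \in _).
    by rewrite divfK // addrC subrK.
  under [RHS]eq_bigr do rewrite scalerDl -scalerA.
  rewrite big_split /= -scaler_sumr [X in _ *: X](_ : _ = 0) ?scaler0 ?addr0 //.
  rewrite -[RHS](sum_block i0) [RHS]big_mkcond; apply: eq_bigr => v _.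
  by case: ifP; rewrite ?scale1r ?scale0r.
- move=> F s Fp Fs w ws _ w0 v.
  (* The face misses some vertex of each block, where [w] vanishes, and a dependence is constant on
     blocks. *)
  have /simplex_joinP/(_ (col v))/subsetPn[x] := face_block_free Fp Fs.
  by rewrite inE => /eqP cx xs; rewrite (dependence_block_constant w0 (esym cx)) ws.
- move=> s; split=> [sK|[F [Fp Fs]]]; last exact: face_block_free Fp Fs.
  have [a ha] := join_functional sK.
  exists (fun x => conv p x /\ (x *m a) 0 0 = 1); split; last first.
    move=> v; rewrite -(ha v).2; split=> [/eqP e|[_ /eqP //]].
    by split; first exact: conv_vertex.
  split.
    exists a, 1; split=> // x [w [w0 w1 ->]].
    rewrite dot_sum -w1 ler_sum // => y _.
    by rewrite -[leRHS]mulr1 ler_wpM2l // (ha y).1.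
  have /simplex_joinP/(_ (Ordinal r_gt0))/subsetPn[x _ xs] := sK.
  exists (p x); split; first exact: conv_vertex.
  by case=> _ /eqP; rewrite (ha x).2 (negPf xs).
Qed.

End FreeSum.

(** * Existence of a free sum of simplices *)

Section FreeSumExistence.
Variables (R : realType) (n r d : nat) (col : 'I_n -> 'I_r).
Hypothesis dn : (d + r = n)%N.
Hypothesis block_gt2 : forall i, (2 < #|block col i|)%N.

Let C : 'M[R]_(n, r) := \matrix_(v, i) (col v == i)%:R.

Lemma rank_incidence : \rank C = r.
Proof.
apply/eqP; rewrite eqn_leq rank_leq_col /=.
have hx i : exists x, x \in block col i.
  by apply/set0Pn; rewrite -card_gt0 ltnW // ltnW.
pose B : 'M[R]_(r, n) := \matrix_(i, v) (v == xchoose (hx i))%:R.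
have e : B *m C = 1%:M.
  apply/matrixP => i j; rewrite !mxE (bigD1 (xchoose (hx i))) //= big1 => [|v /negPf ne].
    rewrite !mxE eqxx mul1r addr0.
    by have := xchooseP (hx i); rewrite inE => /eqP ->.
  by rewrite mxE ne mul0r.
by rewrite -[leqLHS](@mxrank1 R) -e mxrankM_maxr.
Qed.

(** The rows of [Q] form a basis of the functions with zero sum on every block, and the points are
    the columns of [Q]. Thus the linear functionals restricted to the points are exactly those
    functions. *)
Lemma free_sum_exists : (0 < r)%N ->
  exists p : 'I_n -> 'rV[R]_d,
    natural (simplex_join (fun i => ltnW (block_gt2 i))) p.
Proof.
move=> r0.
have e : \rank (kermx C) = d by rewrite mxrank_ker rank_incidence -dn addnK.
pose Q : 'M[R]_(d, n) := castmx (e, erefl n) (row_base (kermx C)).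
have QE : (Q :=: kermx C)%MS.
  by apply: eqmx_trans (eq_row_base _); apply: eqmx_cast.
pose p v : 'rV[R]_d := row v Q^T.
have pa v (a : 'cV[R]_d) : (p v *m a) 0 0 = (a^T *m Q) 0 v.
  by rewrite -[a in LHS]trmxK -row_mul -trmx_mul !mxE.
exists p; apply: free_sum_natural => // [i|g g0|x].
- have : Q *m C = 0 by apply/sub_kermxP; rewrite QE.
  move=> QC; apply/matrixP=> a j; rewrite summxE ord1 [RHS]mxE.
  have /matrixP/(_ j i) := QC; rewrite [RHS]mxE mxE => QC0.
  rewrite -[RHS]QC0 big_mkcond; apply: eq_bigr => v _; rewrite !mxE inE.
  by case: eqP; rewrite ?mulr1 ?mulr0.
- pose G : 'rV[R]_n := \row_v g v.
  have : (G <= Q)%MS.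
    rewrite QE; apply/sub_kermxP/matrixP => a i; rewrite !mxE -[RHS](g0 i).
    rewrite [RHS]big_mkcond; apply: eq_bigr => v _; rewrite !mxE inE.
    by case: eqP; rewrite ?mulr1 ?mulr0.
  by case/submxP=> a aE; exists a^T => v; rewrite pa trmxK -aE mxE.
- have : row_full Q^T.
    rewrite /row_full mxrank_tr QE e //.
  case/row_fullP=> B BQ; exists (fun v => (x *m B) 0 v).
  rewrite -[LHS]mulmx1 -BQ mulmxA; exact: mulmx_sum_row.
Qed.

End FreeSumExistence.

(** * Gale duals and their signs *)

Section GaleDual.
Variables (d : nat).
Local Notation n := (d + 1 + 2)%N.
Variables (i0 i1 : 'I_n).

(** Two unit columns complete the points in homogeneous coordinates to a square matrix. They
    normalise the Gale dual to (D, 0) at [i0] and (0, D) at [i1], where D is the determinant. *)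
Definition gale_mx (F : comNzRingType) (P : 'M[F]_(n, d)) : 'M[F]_n :=
  row_mx (row_mx P (const_mx 1))
    (\matrix_(v < n, j < 2) (v == (if j == 0 then i0 else i1))%:R).

(* The last two rows of the adjugate are, up to scaling, a Gale dual of P. *)
Definition gale (F : comNzRingType) (P : 'M[F]_(n, d)) (j : 'I_2) (v : 'I_n) : F :=
  (\adj (gale_mx P)) (rshift (d + 1) j) v.

Definition bracket (F : comNzRingType) (A B : 'I_n -> F) v w : F :=
  A v * B w - B v * A w.

Lemma gale_mulmx (F : comNzRingType) (P : 'M[F]_(n, d)) j :
  row (rshift (d + 1) j) (\adj (gale_mx P)) *m gale_mx P =
  \det (gale_mx P) *: delta_mx 0 (rshift (d + 1) j).
Proof. by rewrite -row_mul mul_adj_mx rowE mul_mx_scalar. Qed.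

Lemma gale_kernel (F : comNzRingType) (P : 'M[F]_(n, d)) j (k : 'I_d) :
  \sum_v gale P j v * P v k = 0.
Proof.
have /matrixP/(_ 0 (lshift 2 (lshift 1 k))) := gale_mulmx P j.
rewrite !mxE eq_lrshift /= mulr0 => e; rewrite -[RHS]e.
by apply: eq_bigr => v _; rewrite row_mxEl row_mxEl [row _ _ _ _]mxE.
Qed.

Lemma gale_sum (F : comNzRingType) (P : 'M[F]_(n, d)) j :
  \sum_v gale P j v = 0.
Proof.
have /matrixP/(_ 0 (lshift 2 (rshift d 0))) := gale_mulmx P j.
rewrite !mxE eq_lrshift /= mulr0 => e; rewrite -[RHS]e.
by apply: eq_bigr => v _; rewrite row_mxEl row_mxEr [const_mx _ _ _]mxE mulr1 [row _ _ _ _]mxE.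
Qed.

Lemma gale_diag (F : comNzRingType) (P : 'M[F]_(n, d)) j k :
  gale P j (if k == 0 then i0 else i1) = (j == k)%:R * \det (gale_mx P).
Proof.
have /matrixP/(_ 0 (rshift (d + 1) k)) := gale_mulmx P j.
rewrite !mxE eqxx (inj_eq (@rshift_inj _ _)) eq_sym mulrC => <-.
rewrite (bigD1 (if k == 0 then i0 else i1)) //= big1 => [|v /negPf ne].
  by rewrite row_mxEr [row _ _ _ _]mxE [X in _ * X]mxE eqxx mulr1 addr0.
by rewrite row_mxEr [X in _ * X]mxE ne mulr0.
Qed.

(** The matrix times its adjugate, read in column [w]. Multiplied by the variables and summed over
    [v], it says that D times x_w is, modulo the linear forms, A_w x_i0 + B_w x_i1. *)
Lemma gale_span (F : comNzRingType) (P : 'M[F]_(n, d)) w :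
  exists (c : 'I_d -> F) (c1 : F), forall v,
    \det (gale_mx P) * (v == w)%:R = \sum_k P v k * c k + c1
      + (v == i0)%:R * gale P 0 w + (v == i1)%:R * gale P 1 w.
Proof.
exists (fun k => (\adj (gale_mx P)) (lshift 2 (lshift 1 k)) w).
exists ((\adj (gale_mx P)) (lshift 2 (rshift d 0)) w) => v.
transitivity ((gale_mx P *m \adj (gale_mx P)) v w).
  by rewrite mul_mx_adj [RHS]mxE mulr_natr.
rewrite mxE big_split_ord /= big_split_ord /= big_ord1.
rewrite big_ord_recl big_ord1 addrA.
have -> : lift ord0 ord0 = 1 :> 'I_2 by apply/val_inj.
have -> : ord0 = 0 :> 'I_2 by apply/val_inj.
congr (_ + _ + _ + _).
- by apply: eq_bigr => k _; rewrite !row_mxEl.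
- by rewrite row_mxEl row_mxEr [X in X * _]mxE mul1r.
- by rewrite row_mxEr [X in X * _]mxE.
- by rewrite row_mxEr [X in X * _]mxE.
Qed.

Lemma map_gale (F F' : comNzRingType) (f : {rmorphism F -> F'}) (P : 'M[F]_(n, d)) j v :
  gale (map_mx f P) j v = f (gale P j v).
Proof.
rewrite /gale (_ : gale_mx (map_mx f P) = map_mx f (gale_mx P)).
  by rewrite -map_mx_adj mxE.
rewrite /gale_mx !map_row_mx; congr row_mx; first congr row_mx.
  by apply/matrixP=> a b; rewrite !mxE rmorph1.
by apply/matrixP=> a b; rewrite !mxE rmorph_nat.
Qed.

Lemma map_gale_det (F F' : comNzRingType) (f : {rmorphism F -> F'}) (P : 'M[F]_(n, d)) :
  \det (gale_mx (map_mx f P)) = f (\det (gale_mx P)).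
Proof.
by have := map_gale f P 0 i0; have := gale_diag (map_mx f P) 0 0;
  have := gale_diag P 0 0; rewrite /= !mul1r => -> -> ->.
Qed.

End GaleDual.

Lemma ord3P (i : 'I_3) : [\/ i = 0, i = 1 | i = 2].
Proof.
by case: i => -[|[|[|//]]] hi; [apply: Or31|apply: Or32|apply: Or33]; exact/val_inj.
Qed.

(** * Signs of brackets for a natural embedding *)

Section NaturalGale.
Variables (R : realType) (d : nat).
Local Notation n := (d + 1 + 2)%N.
Variables (col : 'I_n -> 'I_3) (block_gt1 : forall i, (1 < #|block col i|)%N).
Variable p : 'I_n -> 'rV[R]_d.
Hypothesis hnat : natural (simplex_join block_gt1) p.

Definition affine_dependence (k : 'I_n -> R) :=
  \sum_v k v = 0 /\ \sum_v k v *: p v = 0.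

(** Omitting one vertex per block leaves a facet. The slack of its hyperplane is zero on the facet
    and positive at [v], [w], [x], so pairing it with an affine dependence gives the positive
    relation; affine independence of the facet gives the second claim. *)
Lemma cofacet v w x : col v = 0 -> col w = 1 -> col x = 2 ->
  exists hv hw hx : R, [/\ 0 < hv, 0 < hw, 0 < hx &
    forall k, affine_dependence k ->
      k v * hv + k w * hw + k x * hx = 0 /\
      (k v = 0 -> k w = 0 -> k x = 0 -> forall y, k y = 0)].
Proof.
move=> cv cw cx; pose s := ~: [set v; w; x].
have wv : w != v by apply/eqP => e; move: cw; rewrite e cv.
have xv : x != v by apply/eqP => e; move: cx; rewrite e cv.
have xw : x != w by apply/eqP => e; move: cx; rewrite e cw.
have sK : s \in faces (simplex_join block_gt1).
  apply/simplex_joinP => i; apply/subsetPn.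
  have [y yi ys] : exists2 y, col y = i & y \in [set v; w; x].
    by case: (ord3P i) => ->; [exists v|exists w|exists x]; rewrite ?inE ?eqxx ?orbT.
  by exists y; rewrite ?inE ?yi ?eqxx // negbK; rewrite !inE in ys.
case: hnat => _ _ simp faceP; have [F [Fp Fs]] := (faceP s).1 sK.
have [[a [b [ab Fab]]] _] := Fp.
pose h y := b - (p y *m a) 0 0.
have h0 y : 0 <= h y by rewrite subr_ge0; apply/ab/conv_vertex.
have hs y : y \in s -> h y = 0 by move=> /Fs /Fab[_ e]; rewrite /h e subrr.
have hn y : y \notin s -> 0 < h y.
  move=> ys; rewrite lt_neqAle h0 andbT; apply: contra ys => /eqP e.
  apply/Fs/Fab; split; first exact: conv_vertex.
  by apply/eqP; rewrite eq_sym -subr_eq0 -/(h y) -e.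
exists (h v), (h w), (h x); split; try by apply: hn; rewrite !inE eqxx ?orbT.
move=> k [k1 kp]; split; last first.
  move=> kv kw kx; apply: (simp F s Fp Fs) => // y; rewrite inE negbK !inE.
  by case/orP=> [/orP[]|] /eqP ->.
have : \sum_y k y * h y = 0.
  under eq_bigr do rewrite mulrBr.
  by rewrite sumrB -mulr_suml k1 mul0r -dot_sum kp mul0mx mxE subrr.
rewrite (bigD1 v) //= (bigD1 w) //= (bigD1 x) ?xv //= big1 ?addr0 ?addrA //.
move=> y /andP[/andP[yv yw] yx]; rewrite hs ?mulr0 //.
by rewrite !inE !negb_or yv yw.
Qed.

(** A positive linear relation among three plane vectors makes their cyclic brackets proportional to
    its coefficients. *)
Lemma bracket_cofacet (A B : 'I_n -> R) v w x :
  affine_dependence A -> affine_dependence B ->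
  col v = 0 -> col w = 1 -> col x = 2 ->
  (0 < bracket A B v w) = (0 < bracket A B w x) /\
  (0 < bracket A B x v) = (0 < bracket A B w x).
Proof.
move=> hA hB cv cw cx; have [hv [hw [hx [v0 w0 x0 h]]]] := cofacet cv cw cx.
have [/(_ A hA)[eA _] /(_ B hB)[eB _]] := (h, h).
have e1 : bracket A B v w * hv = bracket A B w x * hx.
  apply/eqP; rewrite -subr_eq0; apply/eqP; rewrite /bracket.
  have -> : (A v * B w - B v * A w) * hv - (A w * B x - B w * A x) * hx =
    B w * (A v * hv + A w * hw + A x * hx) - A w * (B v * hv + B w * hw + B x * hx) by ring.
  by rewrite eA eB !mulr0 subrr.
have e2 : bracket A B x v * hv = bracket A B w x * hw.
  apply/eqP; rewrite -subr_eq0; apply/eqP; rewrite /bracket.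
  have -> : (A x * B v - B x * A v) * hv - (A w * B x - B w * A x) * hw =
    A x * (B v * hv + B w * hw + B x * hx) - B x * (A v * hv + A w * hw + A x * hx) by ring.
  by rewrite eA eB !mulr0 subrr.
split.
  by rewrite -(pmulr_lgt0 (bracket A B v w) v0) e1 pmulr_lgt0.
by rewrite -(pmulr_lgt0 (bracket A B x v) v0) e2 pmulr_lgt0.
Qed.

Variables (i0 i1 : 'I_n).
Hypotheses (ci0 : col i0 = 0) (ci1 : col i1 = 1).

(** The sign is carried from (i0, i1, x) to (i0, w, x) and then to (v, w, x), consecutive triples
    sharing a bracket. *)
Lemma bracket_gt0 (A B : 'I_n -> R) :
  affine_dependence A -> affine_dependence B -> 0 < bracket A B i0 i1 ->
  forall v w x, col v = 0 -> col w = 1 -> col x = 2 ->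
  [/\ 0 < bracket A B v w, 0 < bracket A B w x & 0 < bracket A B x v].
Proof.
move=> hA hB h01 v w x cv cw cx.
have b1x : 0 < bracket A B i1 x by have [<- _] := bracket_cofacet hA hB ci0 ci1 cx.
have bx0 : 0 < bracket A B x i0 by have [_ ->] := bracket_cofacet hA hB ci0 ci1 cx.
have bwx : 0 < bracket A B w x by have [_ <-] := bracket_cofacet hA hB ci0 cw cx.
by have [-> ->] := bracket_cofacet hA hB cv cw cx.
Qed.

Let P : 'M[R]_(n, d) := \matrix_v p v.

Lemma gale_dependence j : affine_dependence (gale i0 i1 P j).
Proof.
split; first exact: gale_sum.
apply/matrixP=> a k; rewrite ord1 summxE [RHS]mxE -[RHS](gale_kernel i0 i1 P j k).
by apply: eq_bigr => v _; rewrite !mxE.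
Qed.

(** A vector in the left kernel is an affine dependence vanishing at [i0] and [i1]. The relation of
    a cofacet makes it vanish at a third vertex [x], hence everywhere. *)
Lemma gale_det_neq0 : \det (gale_mx i0 i1 P) != 0.
Proof.
apply/negP => /det0P[k k0 /matrixP kS].
have kE j : \sum_v k 0 v * gale_mx i0 i1 P v j = 0.
  by have := kS 0 j; rewrite mxE [RHS]mxE.
have kn (j : 'I_2) : k 0 (if j == 0 then i0 else i1) = 0.
  have := kE (rshift (d + 1) j).
  rewrite (bigD1 (if j == 0 then i0 else i1)) //= big1 => [|v /negPf ne].
    by rewrite row_mxEr mxE eqxx mulr1 addr0.
  by rewrite row_mxEr mxE ne mulr0.
have hk : affine_dependence (k 0).
  split.
    have := kE (lshift 2 (rshift d 0)) => e; rewrite -[RHS]e.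
    by apply: eq_bigr => v _; rewrite row_mxEl row_mxEr mxE mulr1.
  apply/matrixP=> a j; rewrite ord1 summxE [RHS]mxE.
  have := kE (lshift 2 (lshift 1 j)) => e; rewrite -[RHS]e.
  by apply: eq_bigr => v _; rewrite !row_mxEl !mxE.
have /card_gt0P[x] := ltnW (block_gt1 2); rewrite inE => /eqP cx.
have [hv [hw [hx [_ _ x0 /(_ _ hk)[e h]]]]] := cofacet ci0 ci1 cx.
have k00 := kn 0; have k10 := kn 1; rewrite /= in k00 k10.
move: e; rewrite k00 k10 !mul0r !add0r => /eqP; rewrite mulf_eq0 (gt_eqF x0) orbF.
move=> /eqP kx; case/eqP: k0; apply/matrixP=> a y.
by rewrite ord1 [RHS]mxE h.
Qed.

Lemma natural_gale_bracket v w x : col v = 0 -> col w = 1 -> col x = 2 ->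
  let b := bracket (gale i0 i1 P 0) (gale i0 i1 P 1) in
  [/\ 0 < b v w, 0 < b w x & 0 < b x v].
Proof.
move=> cv cw cx b; apply: bracket_gt0 => //; try exact: gale_dependence.
(* The bracket of [i0] and [i1] is the square of the determinant. *)
rewrite /bracket.
have := gale_diag i0 i1 P 0 0; have := gale_diag i0 i1 P 0 1.
have := gale_diag i0 i1 P 1 0; have := gale_diag i0 i1 P 1 1.
rewrite /= !mul0r !mul1r => -> -> -> ->.
by rewrite mulr0 subr0 -expr2 lt_neqAle sqr_ge0 eq_sym sqrf_eq0 gale_det_neq0.
Qed.

End NaturalGale.

(** * Division-free differences of products *)

Section Telescope.
Variable T : Type.
Implicit Types s : seq T.

(* The quotient of [\prod y - \prod x] by [e] when [y z - x z = delta z * e]. *)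
Fixpoint telescope (F : comNzRingType) (delta x y : T -> F) s : F :=
  if s is z :: s' then
    delta z * \prod_(z' <- s') y z' + x z * telescope delta x y s'
  else 0.

Lemma telescopeP (F : comNzRingType) (delta x y : T -> F) e s :
  (forall z, y z - x z = delta z * e) ->
  \prod_(z <- s) y z - \prod_(z <- s) x z = telescope delta x y s * e.
Proof.
move=> h; elim: s => [|z s IH] /=; first by rewrite !big_nil subrr mul0r.
rewrite !big_cons mulrDl -(mulrA (x z)) -IH (mulrAC (delta z)) -h; ring.
Qed.

(** Each term has [size s - 1] factors taken from [x] and [y]; the outer [c] supplies the missing
    one. *)
Lemma telescope_scale (F : comNzRingType) (delta x y : T -> F) c s :
  c * telescope delta (fun z => c * x z) (fun z => c * y z) s =
  c ^+ size s * telescope delta x y s.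
Proof.
elim: s => [|z s IH] /=; first by rewrite !mulr0.
rewrite big_split big_const_seq count_predT iter_mulr_1 exprS /=.
have -> : forall p q : F, c * (delta z * p + c * x z * q) =
    delta z * (c * p) + c * x z * (c * q) by move=> *; ring.
rewrite IH; ring.
Qed.

Lemma rmorph_telescope (F F' : comNzRingType) (f : {rmorphism F -> F'})
    (delta x y : T -> F) s :
  f (telescope delta x y s) =
  telescope (fun z => f (delta z)) (fun z => f (x z)) (fun z => f (y z)) s.
Proof.
elim: s => [|z s IH] /=; first exact: rmorph0.
by rewrite rmorphD !rmorphM IH rmorph_prod.
Qed.

Lemma eq_telescope (F : comNzRingType) (d1 x1 y1 d2 x2 y2 : T -> F) s :
  d1 =1 d2 -> x1 =1 x2 -> y1 =1 y2 -> telescope d1 x1 y1 s = telescope d2 x2 y2 s.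
Proof.
move=> ed ex ey; elim: s => //= z s ->; rewrite ed ex.
by congr (_ * _ + _); apply: eq_bigr.
Qed.

End Telescope.

Lemma telescope_gt0 (T : eqType) (F : realFieldType) (delta x y : T -> F) s :
  s != [::] -> {in s, forall z, [/\ 0 < delta z, 0 < x z & 0 < y z]} ->
  0 < telescope delta x y s.
Proof.
case: s => // z s _; elim: s z => [|z' s IH] z h /=.
  have [d0 x0 y0] := h z (mem_head _ _).
  by rewrite big_nil mulr1 mulr0 addr0.
have [d0 x0 y0] := h z (mem_head _ _).
apply: addr_gt0; last first.
  by rewrite mulr_gt0 // IH // => y' hy; apply: h; rewrite inE hy orbT.
rewrite mulr_gt0 // big_seq prodr_gt0 // => y' hy.
by have [] : [/\ 0 < delta y', 0 < x y' & 0 < y y'] by apply: h; rewrite inE hy orbT.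
Qed.

(** * From one nonvanishing instance to all generic embeddings *)

Section GenericTransfer.
Variables (R : realType) (n d : nat).

(** An expression compatible with all ring morphisms is determined by its value at a matrix of
    indeterminates over the rationals. That polynomial is nonzero since it specialises to a nonzero
    value at [P0], and algebraic independence keeps it nonzero at [p]. *)
Lemma generic_neq0 (phi : forall F : comNzRingType, 'M[F]_(n, d) -> F) :
  (forall (F F' : comNzRingType) (f : {rmorphism F -> F'}) P,
     phi F' (map_mx f P) = f (phi F P)) ->
  (exists P0, phi R P0 != 0) ->
  forall p : 'I_n -> 'rV[R]_d, generic p -> phi R (\matrix_v p v) != 0.
Proof.
move=> phiM [P0 P00] p hp; pose N := #|{: 'I_n * 'I_d}|.
pose X : 'M[{mpoly rat[N]}]_(n, d) := \matrix_(v, j) 'X_(enum_rank (v, j)).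
pose ev (P : 'M[R]_(n, d)) (k : 'I_N) : R := P (enum_val k).1 (enum_val k).2.
pose mu P : {mpoly rat[N]} -> R := meval (ev P) \o map_mpoly (ratr : rat -> R).
have muX P : map_mx (mu P) X = P.
  apply/matrixP=> v j; rewrite !mxE /mu /= map_mpolyX mevalXU /ev enum_rankK //.
have X0 : phi _ X != 0.
  apply: contra P00 => /eqP e; rewrite -[P0]muX (phiM _ _ (mu P0)) e; exact/eqP/rmorph0.
apply: contra X0 => /eqP e; apply/eqP/hp.
rewrite -[RHS]e -[\matrix_v _ in RHS]muX phiM /mu /=; apply: meval_eq => k.
by rewrite /ev mxE.
Qed.

End GenericTransfer.

(** * Conditions shared by natural and generic embeddings *)

Section GoodPosition.
Variables (d : nat).
Local Notation n := (d + 1 + 2)%N.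
Variables (col : 'I_n -> 'I_3) (block_gt1 : forall i, (1 < #|block col i|)%N).
Variables (i0 i1 a b : 'I_n).
Variable s : seq ('I_n * 'I_n).
Hypotheses (ci0 : col i0 = 0) (ci1 : col i1 = 1) (ca : col a = 2) (cb : col b = 2).
Hypothesis s0 : s != [::].
Hypothesis sP : {in s, forall z, col z.1 = 0 /\ col z.2 = 1}.

(** By the Plücker relation the two products at [z] differ by [bracket A B z.1 z.2] times
    [bracket A B a b]. So this is, up to scaling, the determinant of the values of f1 and f2 at the
    roots of [a] and [b], divided by [bracket A B a b]. Every bracket in it follows the cyclic order
    of the blocks, hence is positive in natural position. *)
Definition gale_telescope (F : comNzRingType) (A B : 'I_n -> F) : F :=
  telescope (fun z => bracket A B z.1 z.2)
    (fun z => bracket A B a z.1 * bracket A B z.2 b)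
    (fun z => bracket A B b z.1 * bracket A B z.2 a) s.

(** In order: f1 and f2 have no common root, which bounds the degrees of A(K); f3 keeps degree 3
    when t is set to 1; f1 and f2 are independent modulo f3. *)
Definition good_position (F : comNzRingType) (A B : 'I_n -> F) :=
  [/\ forall v w, col v = 0 -> col w = 1 -> bracket A B v w != 0,
      forall x, col x = 2 -> B x != 0
    & gale_telescope A B != 0].

Lemma map_bracket (F F' : comNzRingType) (f : {rmorphism F -> F'}) (A B : 'I_n -> F) v w :
  f (bracket A B v w) = bracket (f \o A) (f \o B) v w.
Proof. by rewrite /bracket rmorphB !rmorphM. Qed.

Variable R : realType.

Lemma natural_good_position (p : 'I_n -> 'rV[R]_d) :
  natural (simplex_join block_gt1) p ->
  \det (gale_mx i0 i1 (\matrix_v p v)) != 0 /\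
  good_position (gale i0 i1 (\matrix_v p v) 0) (gale i0 i1 (\matrix_v p v) 1).
Proof.
move=> hp; have br := natural_gale_bracket hp ci0 ci1.
split; first exact: gale_det_neq0 hp _ _ ci0 ci1.
split=> [v w cv cw|x cx|].
- by have [/gt_eqF->] := br v w a cv cw ca.
- have [_ _] := br i0 i1 x ci0 ci1 cx; rewrite /bracket.
  have := gale_diag i0 i1 (\matrix_v p v) 1 0; rewrite /= mul0r => ->.
  rewrite mulr0 sub0r oppr_gt0 => h; apply: contraTneq h => ->.
  by rewrite mul0r ltxx.
- rewrite gt_eqF //; apply: telescope_gt0 => // z /sP[c1 c2].
  have [h1 h2 h3] := br _ _ _ c1 c2 ca; have [_ h5 h6] := br _ _ _ c1 c2 cb.
  by split=> //; apply: mulr_gt0.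
Qed.

Lemma generic_good_position (p0 p : 'I_n -> 'rV[R]_d) :
  natural (simplex_join block_gt1) p0 -> generic p ->
  \det (gale_mx i0 i1 (\matrix_v p v)) != 0 /\
  good_position (gale i0 i1 (\matrix_v p v) 0) (gale i0 i1 (\matrix_v p v) 1).
Proof.
move=> /natural_good_position[D0 [g1 g2 g3]] hp.
have brM (F F' : comNzRingType) (f : {rmorphism F -> F'}) (P : 'M[F]_(n, d)) v w :
    bracket (gale i0 i1 (map_mx f P) 0) (gale i0 i1 (map_mx f P) 1) v w =
    f (bracket (gale i0 i1 P 0) (gale i0 i1 P 1) v w).
  by rewrite map_bracket /bracket !map_gale.
split; first (apply: (@generic_neq0 R n d (fun F P => \det (gale_mx i0 i1 P))) => //).
- by move=> F F' f P; exact: map_gale_det.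
- by exists (\matrix_v p0 v).
split=> [v w cv cw|x cx|].
- apply: (@generic_neq0 R n d
    (fun F P => bracket (gale i0 i1 P 0) (gale i0 i1 P 1) v w)) => //.
  by exists (\matrix_v p0 v); apply: g1.
- apply: (@generic_neq0 R n d (fun F P => gale i0 i1 P 1 x)) => //.
    by move=> F F' f P; exact: map_gale.
  by exists (\matrix_v p0 v); apply: g2.
- apply: (@generic_neq0 R n d
    (fun F P => gale_telescope (gale i0 i1 P 0) (gale i0 i1 P 1))) => //.
    move=> F F' f P; rewrite /gale_telescope rmorph_telescope.
    by apply: eq_telescope => z; rewrite ?rmorphM !(brM F F' f P).
  by exists (\matrix_v p0 v).
Qed.

End GoodPosition.

(** * Binary forms modulo a cubic *)

Section ModCubic.
Variables (F : fieldType) (f3 : {poly F}).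

Definition mod_row (q : {poly F}) : 'rV[F]_3 := poly_rV (q %% f3).

Lemma mod_row_is_linear : linear mod_row.
Proof. by move=> a p q; rewrite /mod_row modpD modpZl linearP. Qed.

HB.instance Definition _ :=
  GRing.isLinear.Build F {poly F} 'rV[F]_3 _ mod_row mod_row_is_linear.

Hypothesis size_f3 : size f3 = 4%N.

Let f3_neq0 : f3 != 0. Proof. by rewrite -size_poly_eq0 size_f3. Qed.

Lemma size_modf3 q : (size (q %% f3)%R <= 3)%N.
Proof. by rewrite -ltnS -size_f3 ltn_modp. Qed.

Lemma mod_row_eq0 q : (mod_row q == 0) = (f3 %| q).
Proof.
apply/eqP/modp_eq0P => [/(congr1 (@rVpoly _ 3))|h].
  by rewrite poly_rV_K ?size_modf3 // raddf0.
by rewrite /mod_row h raddf0.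
Qed.

Variables f1 f2 : {poly F}.
Hypothesis indep : forall a b, f3 %| a *: f1 + b *: f2 -> a = 0 /\ b = 0.

(** The residues of 1, X and X^2 span a three-dimensional space, too large for two polynomials. *)
Lemma monomial_not_in_span : exists2 i, (i < 3)%N &
  forall a b, ~~ (f3 %| 'X^i - (a *: f1 + b *: f2)).
Proof.
apply: contrapT => h.
have hi (i : 'I_3) : exists ab : F * F, f3 %| 'X^i - (ab.1 *: f1 + ab.2 *: f2).
  apply: contrapT => hi; apply: h; exists (nat_of_ord i); first exact: ltn_ord.
  move=> a b; apply/negP => e.
  by apply: hi; exists (a, b).
pose ab i := xchoose (hi i).
have : (\rank (1%:M : 'M[F]_3) <= 2)%N.
  pose N : 'M[F]_(3, 2) := \matrix_(i, j) if j == 0 then (ab i).1 else (ab i).2.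
  pose Q : 'M[F]_(2, 3) := \matrix_(j < 2) if j == 0 then mod_row f1 else mod_row f2.
  have -> : 1%:M = N *m Q; last exact: leq_trans (mxrankM_maxr _ _) (rank_leq_row _).
  apply/row_matrixP=> i; rewrite row_mul mulmx_sum_row !big_ord_recl big_ord0 addr0.
  rewrite !rowK !mxE /=.
  have := xchooseP (hi i); rewrite -mod_row_eq0 linearB subr_eq0 linearD !linearZ /=.
  move=> /eqP <-; rewrite /mod_row modp_small; last by rewrite size_polyXn size_f3 ltnS ltn_ord.
  by apply/matrixP=> x y; rewrite !mxE coefXn eq_sym.
by rewrite mxrank1.
Qed.

(* The four rows [X f1], [X f2], [f1], [f2] modulo [f3] are linearly dependent. *)
Lemma socle_poly : exists2 Y : {poly F}, (Y != 0) && (size Y <= 3)%N &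
  forall c0 c1, exists a b, f3 %| (c0%:P + c1 *: 'X) * Y - (a *: f1 + b *: f2).
Proof.
pose M : 'M[F]_(4, 3) := \matrix_(i < 4)
  mod_row (tnth [tuple 'X * f1; 'X * f2; f1; f2] i).
have : kermx M != 0.
  rewrite -mxrank_eq0 mxrank_ker -lt0n subn_gt0.
  exact: leq_ltn_trans (rank_leq_col _) _.
case/rowV0Pn=> k /sub_kermxP kM k0.
have e : f3 %| 'X * (k 0 0 *: f1 + k 0 1 *: f2) + (k 0 2%:R *: f1 + k 0 3%:R *: f2).
  rewrite -mod_row_eq0 -[X in _ == X]kM mulmx_sum_row !big_ord_recl big_ord0 !rowK.
  rewrite mulrDr -!scalerAr !linearD !linearZ /= addr0 -!addrA; apply/eqP.
  have kE (i j : 'I_4) : i = j :> nat -> k 0 i = k 0 j.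
    by move=> ij; congr (fun_of_matrix k 0 _); exact/val_inj.
  congr (_ *: _ + (_ *: _ + (_ *: _ + _ *: _))); exact: kE.
(* Modulo [f3] both [Z] and ['X * Z] lie in the span of [f1] and [f2], hence so does any polynomial
   of degree at most 1 times [Z]. By independence, [Z = 0] modulo [f3] would annihilate all four
   coefficients. *)
pose Z := k 0 0 *: f1 + k 0 1 *: f2.
have eZ : f3 %| Z %% f3 - Z by apply/modp_eq0P; rewrite modpD modpN modp_id subrr.
exists (Z %% f3).
  rewrite size_modf3 andbT; apply: contra k0 => h; have [k00 k01] := indep h.
  move: e; rewrite k00 k01 !scale0r addr0 mulr0 add0r => /indep[k2 k3].
  apply/eqP/matrixP=> i j; rewrite ord1 [RHS]mxE.
  by case: j => -[|[|[|[|//]]]] hj;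
    [rewrite -k00|rewrite -k01|rewrite -k2|rewrite -k3]; congr (fun_of_matrix k 0 _); exact/val_inj.
move=> c0 c1.
exists (c0 * k 0 0 - c1 * k 0 2%:R), (c0 * k 0 1 - c1 * k 0 3%:R).
have -> : (c0%:P + c1 *: 'X) * (Z %% f3) - ((c0 * k 0 0 - c1 * k 0 2%:R) *: f1
    + (c0 * k 0 1 - c1 * k 0 3%:R) *: f2) =
  (c0%:P + c1 *: 'X) * (Z %% f3 - Z) +
  c1 *: ('X * Z + (k 0 2%:R *: f1 + k 0 3%:R *: f2)).
  rewrite /Z -!mul_polyC !(rmorphB, rmorphM) /=; ring.
by rewrite dvdp_add ?dvdp_mull // -mul_polyC dvdp_mull.
Qed.

End ModCubic.

(** * Independence modulo two linear factors, possibly with a common root *)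

Section Independence.
Variables (F : fieldType) (d : nat).
Local Notation n := (d + 1 + 2)%N.
Variables (A B : 'I_n -> F) (a b : 'I_n) (s : seq ('I_n * 'I_n)).

(* The linear form A v * t + B v * s at t = 1, s = 'X. *)
Definition lin_poly (v : 'I_n) : {poly F} := (A v)%:P + B v *: 'X.

Hypotheses (Ba : B a != 0) (Bb : B b != 0).
Hypothesis tel0 : gale_telescope a b s A B != 0.

Let r x := - (A x / B x).
Let f1 := \prod_(z <- s) lin_poly z.1.
Let f2 := \prod_(z <- s) lin_poly z.2.

Lemma lin_poly_root x v : B x != 0 -> (lin_poly v).[r x] = bracket A B v x / B x.
Proof.
move=> Bx; rewrite /lin_poly hornerD hornerC hornerZ hornerX /r /bracket.
by field.
Qed.

Lemma lin_polyE x : B x != 0 -> lin_poly x = B x *: ('X - (r x)%:P).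
Proof.
move=> Bx; rewrite /lin_poly /r polyCN opprK scalerDr [LHS]addrC; congr (_ + _).
by rewrite -mul_polyC -polyCM mulrC divfK.
Qed.

(** Eliminating [f2] by its value at [r a] turns the combination [H] into [alpha] times a multiple
    [T] of ['X - r a]. As [H] is divisible by both linear factors, cancelling that of [a] and
    evaluating at [r b] gives [alpha * T.[r b] = 0], even if the two roots agree. Eliminating [f1]
    handles [beta]. *)
Lemma prod_lin_poly_independent alpha beta :
  lin_poly a * lin_poly b %| alpha *: f1 + beta *: f2 -> alpha = 0 /\ beta = 0.
Proof.
set H := _ + _ => abH.
have [Q HE] : exists Q, H = Q * (('X - (r a)%:P) * ('X - (r b)%:P)).
  exists ((H %/ (lin_poly a * lin_poly b)) * (B a * B b)%:P).
  rewrite -[LHS](divpK abH) !lin_polyE // -!mul_polyC polyCM; ring.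
have Ha : H.[r a] = 0 by rewrite HE !hornerM hornerXsubC subrr mul0r mulr0.
pose T := telescope (fun z => (bracket A B z.1 z.2)%:P)
  (fun z => (lin_poly z.1).[r a]%:P * lin_poly z.2)
  (fun z => lin_poly z.1 * (lin_poly z.2).[r a]%:P) s.
have TE : f1 * f2.[r a]%:P - f1.[r a]%:P * f2 = T * - ('X - (r a)%:P).
  rewrite /T -(@telescopeP _ _ _ _ _ (- ('X - (r a)%:P))).
    by rewrite !big_split /= !horner_prod !rmorph_prod.
  move=> z; rewrite /lin_poly /bracket !hornerE -!mul_polyC.
  rewrite !(rmorphB, rmorphD, rmorphM) /=; ring.
have Tb : T.[r b] != 0.
  (* Values of linear factors at the roots are brackets over [B a] or [B b]; [c] collects both
     denominators and the sign of one reversed bracket. *)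
  pose c := - (B a * B b)^-1.
  have c0 : c != 0 by rewrite oppr_eq0 invr_eq0 mulf_neq0.
  suff e : c * T.[r b] = c ^+ size s * gale_telescope a b s A B.
    have : c * T.[r b] != 0 by rewrite e mulf_neq0 // expf_neq0.
    by rewrite mulf_eq0 negb_or => /andP[].
  rewrite -telescope_scale; congr (_ * _).
  rewrite -[LHS]/(horner_eval (r b) T) /T rmorph_telescope.
  apply: eq_telescope => z; rewrite /= /horner_eval ?hornerM ?hornerC ?lin_poly_root // /bracket /c.
    by field; rewrite Ba Bb.
  by field; rewrite Ba Bb.
have xa : 'X - (r a)%:P != 0 by rewrite polyXsubC_eq0.
have conc (g : F) P : P * ('X - (r a)%:P) = g *: (T * - ('X - (r a)%:P)) ->
    P.[r b] = 0 -> g = 0.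
  rewrite mulrN -mulNr scalerAl => /(mulIf xa) -> /eqP.
  by rewrite hornerZ hornerN mulf_eq0 oppr_eq0 (negPf Tb) orbF => /eqP.
have HfE f : f.[r a]%:P * H - f * H.[r a]%:P =
    f.[r a]%:P * (Q * ('X - (r b)%:P)) * ('X - (r a)%:P).
  by rewrite Ha mulr0 subr0 [in LHS]HE; ring.
have Hra : H.[r a] = alpha * f1.[r a] + beta * f2.[r a] by rewrite !hornerE.
split.
  apply: (@conc _ (f2.[r a]%:P * (Q * ('X - (r b)%:P)))).
    rewrite -HfE -TE Hra /H -!mul_polyC !(rmorphD, rmorphM) /=; ring.
  by rewrite !hornerM hornerXsubC subrr !mulr0.
apply: oppr_inj; rewrite oppr0.
apply: (@conc _ (f1.[r a]%:P * (Q * ('X - (r b)%:P)))).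
  rewrite -HfE -TE Hra /H -!mul_polyC !(rmorphD, rmorphM, rmorphN) /=; ring.
by rewrite !hornerM hornerXsubC subrr !mulr0.
Qed.

End Independence.

(** * Substitution of the binary linear forms for the variables *)

Section BinaryForms.
Variables (R : realType) (d : nat).
Local Notation n := (d + 1 + 2)%N.
Variables (A B : 'I_n -> R).
Implicit Types f g : {mpoly R[n]}.

(* The outer variable records the degree. *)
Definition to_binary f : {poly {poly R}} :=
  mmap (@polyC _ \o @polyC R) (fun v => (lin_poly A B v)%:P * 'X) f.

Lemma to_binary_is_additive : additive to_binary.
Proof. exact: mmap_is_additive. Qed.

Lemma to_binary_is_multiplicative : multiplicative to_binary.
Proof. exact: mmap_is_multiplicative. Qed.

HB.instance Definition _ := GRing.isAdditive.Build {mpoly R[n]} {poly {poly R}}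
  to_binary to_binary_is_additive.

HB.instance Definition _ := GRing.isMultiplicative.Build {mpoly R[n]} {poly {poly R}}
  to_binary to_binary_is_multiplicative.

Definition binary_part k f : {poly R} := (to_binary f)`_k.

Lemma to_binaryXU v : to_binary 'X_v = (lin_poly A B v)%:P * 'X.
Proof. by rewrite /to_binary mmapX mmap1U. Qed.

Lemma to_binaryZ c f : to_binary (c *: f) = c%:P%:P * to_binary f.
Proof. by rewrite /to_binary mmapZ. Qed.

Lemma to_binaryX m :
  to_binary 'X_[m] = (\prod_v lin_poly A B v ^+ m v)%:P * 'X^(mdeg m).
Proof.
rewrite /to_binary mmapX mdegE -prodrXr rmorph_prod -big_split.
by apply: eq_bigr => v _; rewrite exprMn rmorphXn.
Qed.

Lemma to_binaryE f : to_binary f =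
  \sum_(m <- msupp f) (f@_m *: \prod_v lin_poly A B v ^+ m v)%:P * 'X^(mdeg m).
Proof.
rewrite {1}[f]mpolyE raddf_sum; apply: eq_bigr => m _.
by rewrite /= to_binaryZ to_binaryX mulrA -polyCM -mul_polyC.
Qed.

Lemma to_binary_homog k f : f \is k.-homog -> to_binary f = (binary_part k f)%:P * 'X^k.
Proof.
move=> fk; rewrite /binary_part to_binaryE coef_sum rmorph_sum mulr_suml.
rewrite big_seq [RHS]big_seq; apply: eq_bigr => m mf.
by rewrite (dhomog_mf fk mf) coefCM coefXn eqxx mulr1.
Qed.

Lemma binary_part_homog k j f : f \is k.-homog -> j != k -> binary_part j f = 0.
Proof.
by move=> fk /negPf jk; rewrite /binary_part (to_binary_homog fk) coefCM coefXn jk mulr0.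
Qed.

Lemma size_binary_part k f : (size (binary_part k f) <= k.+1)%N.
Proof.
rewrite /binary_part to_binaryE coef_sum (leq_trans (size_sum _ _ _)) //.
apply/bigmax_leqP_seq => m _ _; rewrite coefCM coefXn.
case: eqP => [->|_]; last by rewrite mulr0 size_poly0.
rewrite mulr1 (leq_trans (size_scale_leq _ _)) // mdegE.
have lin2 v : (size (lin_poly A B v) <= 2)%N.
  rewrite /lin_poly (leq_trans (size_polyD _ _)) // geq_max (leq_trans (size_polyC_leq1 _)) //.
  by rewrite (leq_trans (size_scale_leq _ _)) // size_polyX.
elim/big_rec2: _ => [|v k' q _ IH]; first by rewrite size_poly1.
have : (size (lin_poly A B v ^+ m v) <= (m v).+1)%N.
  rewrite (leq_trans (size_poly_exp_leq _ _)) // ltnS -[leqRHS]mul1n leq_mul2r.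
  by apply/orP; right; move: (lin2 v); case: size.
move: (lin_poly A B v ^+ m v) => e he; rewrite (leq_trans (size_polyMleq _ _)) //.
by have := leq_add he IH; rewrite addSn addnS; case: (_ + _)%N.
Qed.

Lemma binary_partM k l f g : f \is k.-homog -> binary_part l (f * g) =
  if (k <= l)%N then binary_part k f * binary_part (l - k) g else 0.
Proof.
move=> fk; rewrite {1}/binary_part rmorphM /= (to_binary_homog fk) -mulrA coefCM.
by rewrite coefXnM ltnNge; case: (k <= l)%N; rewrite //= mulr0.
Qed.

End BinaryForms.

(** * Stresses and inverse systems *)

Section DifferentialAction.
Variables (R : realType) (n : nat).
Implicit Types (mu nu f : {mpoly R[n]}) (m : 'X_{1..n}).

Lemma pdiffE k mu f : (msize mu <= k)%N ->
  pdiff mu f = \sum_(m : 'X_{1..n < k}) mu@_m *: f^`M[m].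
Proof.
move=> muk; rewrite /pdiff; set I : subFinType _ := 'X_{1..n < k}.
rewrite (big_mksub I) ?msupp_uniq //=; first last.
  by move=> x /msize_mdeg_lt /leq_trans; apply.
by rewrite big_rmcond //= => j /memN_msupp_eq0 ->; rewrite scale0r.
Qed.

Lemma pdiff_linearl c mu nu f :
  pdiff (c *: mu + nu) f = c *: pdiff mu f + pdiff nu f.
Proof.
pose k := maxn (msize (c *: mu + nu)) (maxn (msize mu) (msize nu)).
rewrite !(@pdiffE k); rewrite ?leq_max ?leqnn ?orbT //.
rewrite scaler_sumr -big_split; apply: eq_bigr => m _.
by rewrite mcoeffD mcoeffZ scalerDl scalerA.
Qed.

Lemma pdiff0l f : pdiff 0 f = 0.
Proof. by rewrite /pdiff msupp0 big_nil. Qed.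

Lemma pdiff_suml (T : Type) (r : seq T) (c : T -> R) (F : T -> {mpoly R[n]}) f :
  pdiff (\sum_(i <- r) c i *: F i) f = \sum_(i <- r) c i *: pdiff (F i) f.
Proof.
elim: r => [|i r IH]; first by rewrite !big_nil pdiff0l.
by rewrite !big_cons pdiff_linearl IH.
Qed.

Lemma pdiffX m f : pdiff 'X_[m] f = f^`M[m].
Proof. by rewrite /pdiff msuppX big_seq1 mcoeffX eqxx scale1r. Qed.

Lemma pdiff0r mu : pdiff mu 0 = 0.
Proof. by rewrite /pdiff big1 // => m _; rewrite linear0 scaler0. Qed.

Lemma pdiffXM m nu f : pdiff ('X_[m] * nu) f = (pdiff nu f)^`M[m].
Proof.
rewrite {1}[nu]mpolyE mulr_sumr; under eq_bigr do rewrite -scalerAr -mpolyXD.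
rewrite pdiff_suml [in RHS]/pdiff linear_sum; apply: eq_bigr => k _.
by rewrite linearZ /= pdiffX addmC mderivmDm.
Qed.

Lemma pdiffM mu nu f : pdiff (mu * nu) f = pdiff mu (pdiff nu f).
Proof.
rewrite {1}[mu]mpolyE mulr_suml; under eq_bigr do rewrite -scalerAl.
by rewrite pdiff_suml; apply: eq_bigr => m _; rewrite pdiffXM.
Qed.

Lemma pdiff_linear_form (c : 'I_n -> R) f :
  pdiff (\sum_v c v *: 'X_v) f = \sum_v c v *: f^`M(v).
Proof. by rewrite pdiff_suml; apply: eq_bigr => v _; rewrite pdiffX mderivmU1m. Qed.

End DifferentialAction.

(** * Stresses as functionals vanishing on the ideal *)

Section InverseSystem.
Variables (R : realType) (n d : nat) (K : complex n) (p : 'I_n -> 'rV[R]_d).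
Let I := affine_ideal K p.

Lemma affine_gen_ideal g : affine_gen K p g -> g \in I.
Proof.
move=> gG; apply/asboolP; exists [:: (1, g)]; rewrite big_seq1 mul1r; split=> //.
by move=> hg; rewrite inE => /eqP ->.
Qed.

Lemma nonface_missing (s : {set 'I_n}) : s \notin faces K ->
  exists2 t : {set 'I_n}, t \subset s & missing_face K t.
Proof.
move=> sK; have [k sk] := ubnP #|s|; elim: k s sK sk => // k IH s sK; rewrite ltnS => sk.
have [[t [ts tK]]|h] := pselect (exists t : {set 'I_n}, t \proper s /\ t \notin faces K).
  have [t' t't tm] := IH t tK (leq_trans (proper_card ts) sk).
  by exists t' => //; apply: subset_trans t't (proper_sub ts).
exists s => //; split=> // t ts; apply/negPn/negP => tK.
by apply: h; exists t.
Qed.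

Lemma prod_mpolyX (s : {set 'I_n}) :
  \prod_(v in s) 'X_v = 'X_[\sum_(v in s) U_(v)] :> {mpoly R[n]}.
Proof.
elim/big_rec2: _ => [|v m q _ ->]; first by rewrite mpolyX0.
by rewrite mpolyXD.
Qed.

Lemma mnm_indicator (s : {set 'I_n}) v : (\sum_(w in s) U_(w))%MM v = (v \in s).
Proof.
rewrite mnm_sumE; under eq_bigr do rewrite mnm1E.
rewrite big_mkcond (bigD1 v) //= eqxx big1 => [|w /negPf ->]; last by case: ifP.
by rewrite addn0; case: ifP.
Qed.

Lemma nonface_monomial_ideal (m : 'X_{1..n}) : [set v | m v != 0%N] \notin faces K ->
  'X_[m] \in I.
Proof.
case/nonface_missing=> t tm tK.
have le : (\sum_(v in t) U_(v) <= m)%MM.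
  apply/mnm_lepP => v; rewrite mnm_indicator; case: (boolP (v \in t)) => // vt.
  by have := subsetP tm _ vt; rewrite inE lt0n.
rewrite -(submK le) mpolyXD; apply: idealMr; rewrite -prod_mpolyX.
by apply/affine_gen_ideal/Or31; exists t.
Qed.

(** It suffices to treat generators. Differentiating by the monomial of a missing face keeps only
    terms whose support contains that face, and a stress has none. *)
Lemma affine_stress_ideal k omega g : affine_stress K p k omega -> g \in I ->
  pdiff g omega = 0.
Proof.
case=> _ supp th cs /asboolP[s [sG ->]].
rewrite (eq_bigr (fun hg => (1 : R) *: (hg.1 * hg.2))) => [|hg _]; last by rewrite scale1r.
rewrite pdiff_suml big_seq big1 // => hg /sG hG; rewrite scale1r pdiffM.
rewrite [pdiff hg.2 _](_ : _ = 0) ?pdiff0r //.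
case: hG => [[t [[tK _] ->]]|[j ->]|->]; rewrite ?th ?cs //.
rewrite prod_mpolyX pdiffX; apply/mpolyP => m; rewrite mcoeff_mderivm mcoeff0.
have [/supp h|/memN_msupp_eq0 ->] :=
  boolP ((\sum_(v in t) U_(v) + m)%MM \in msupp omega); last by rewrite mul0rn.
case/negP: tK; apply: (complexS _ h); apply/subsetP => v vt.
by rewrite inE mnmDE mnm_indicator vt.
Qed.

Variables (k : nat) (phi : {mpoly R[n]} -> R).
Hypothesis phi_linear : forall c f g, phi (c *: f + g) = c * phi f + phi g.
Hypothesis phi_ideal : forall f, f \in I -> phi f = 0.

Definition mnm_fact (m : 'X_{1..n}) : R := (\prod_v (m v)`!)%:R.

Lemma mnm_fact_neq0 m : mnm_fact m != 0.
Proof. by rewrite pnatr_eq0 -lt0n prodn_gt0 // => v; exact: fact_gt0. Qed.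

(** Macaulay's inverse system: the factorials compensate for differentiation, since applying the
    monomial [m] to itself gives [mnm_fact m]. *)
Definition dual_coef m : R := if mdeg m == k then phi 'X_[m] / mnm_fact m else 0.

Definition dual_stress : {mpoly R[n]} :=
  \sum_(m : 'X_{1..n < k.+1}) dual_coef m *: 'X_[m].

Lemma mcoeff_dual_stress m : dual_stress@_m = dual_coef m.
Proof.
have [mk|km] := ltnP (mdeg m) k.+1; first exact: mcoeff_mpoly.
rewrite raddf_sum big1 /= => [|m' _].
  by rewrite /dual_coef gtn_eqF.
rewrite mcoeffZ mcoeffX; case: eqP => [e|]; last by rewrite mulr0.
by have := bmdeg m'; rewrite e ltnNge km.
Qed.

Lemma phi0 : phi 0 = 0.
Proof. by apply: phi_ideal; exact: rpred0. Qed.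

Lemma phi_sum (T : Type) (r : seq T) (c : T -> R) (F : T -> {mpoly R[n]}) :
  phi (\sum_(i <- r) c i *: F i) = \sum_(i <- r) c i * phi (F i).
Proof.
elim: r => [|i r IH]; first by rewrite !big_nil phi0.
by rewrite !big_cons phi_linear IH.
Qed.

Lemma mnm_factS m v : mnm_fact (m + U_(v)) = mnm_fact m * (m v).+1%:R.
Proof.
rewrite /mnm_fact -natrM; congr _%:R.
rewrite (bigD1 v) //= [in RHS](bigD1 v) //= mnmDE mnm1E eqxx addn1 factS.
rewrite mulnAC mulnC -!mulnA; congr (_ * _)%N; rewrite mulnC; congr (_ * _)%N.
by apply: eq_bigr => w /negPf ne; rewrite mnmDE mnm1E eq_sym ne addn0.
Qed.

(** Up to [mnm_fact m], the coefficient at [m] of the derivative is [phi] of the linear form times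
    ['X_[m]], which lies in the ideal. *)
Lemma dual_stress_linear_form (c : 'I_n -> R) :
  \sum_v c v *: 'X_v \in I -> pdiff (\sum_v c v *: 'X_v) dual_stress = 0.
Proof.
move=> cI; rewrite pdiff_linear_form; apply/mpolyP => m; rewrite mcoeff0 raddf_sum /=.
have [mk|mk] := eqVneq (mdeg m).+1 k; last first.
  rewrite big1 // => v _; rewrite mcoeffZ mcoeff_mderiv mcoeff_dual_stress.
  by rewrite /dual_coef mdegD mdeg1 addn1 (negPf mk) mul0rn mulr0.
have : phi ('X_[m] * \sum_v c v *: 'X_v) = 0 by apply/phi_ideal/idealMr.
rewrite mulr_sumr (eq_bigr (fun v => c v *: 'X_[m + U_(v)])) => [|v _]; last first.
  by rewrite -scalerAr mpolyXD.
rewrite phi_sum => e; apply: (mulIf (mnm_fact_neq0 m)); rewrite mul0r -[RHS]e mulr_suml.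
apply: eq_bigr => v _; rewrite mcoeffZ mcoeff_mderiv mcoeff_dual_stress.
rewrite /dual_coef mdegD mdeg1 addn1 mk eqxx mnm_factS -[X in _ * X * _]mulr_natr.
have S0 : (m v).+1%:R != 0 :> R by rewrite pnatr_eq0.
move: (m v).+1%:R S0 (mnm_fact_neq0 m) => S S0 m0; by field; rewrite S0 m0.
Qed.

Lemma dual_stress_affine : affine_stress K p k dual_stress.
Proof.
split=> [|m|j|].
- apply/dhomogP => m; rewrite mcoeff_msupp mcoeff_dual_stress /dual_coef /=.
  by have [|_] := eqVneq (mdeg m) k; rewrite // eqxx.
- rewrite mcoeff_msupp mcoeff_dual_stress /dual_coef.
  have [_|_] := eqVneq (mdeg m) k; last by rewrite eqxx.
  apply: contraNT => /nonface_monomial_ideal /phi_ideal ->.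
  by rewrite mul0r.
- by apply: dual_stress_linear_form; apply/affine_gen_ideal/Or32; exists j.
- have e : csum R n = \sum_v 1 *: 'X_v by apply: eq_bigr => v _; rewrite scale1r.
  by rewrite e; apply: dual_stress_linear_form; rewrite -e; apply/affine_gen_ideal/Or33.
Qed.

Lemma dual_stress_pairing f : f \is k.-homog -> (pdiff f dual_stress)@_0 = phi f.
Proof.
move=> fk; rewrite {2}[f]mpolyE phi_sum /pdiff raddf_sum /=.
rewrite big_seq [RHS]big_seq; apply: eq_bigr => m mf.
rewrite mcoeffZ mcoeff_mderivm addm0 mcoeff_dual_stress /dual_coef (dhomog_mf fk mf) eqxx.
rewrite (eq_bigr (fun v => (m v)`!)) => [|v _]; last by rewrite ffactnn.
by rewrite -mulr_natr -/(mnm_fact m) divfK // mnm_fact_neq0.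
Qed.

End InverseSystem.

(** * The reduction to two variables *)

Section AffineIdeal.
Variables (R : realType) (d u : nat).
Local Notation n := (d + 1 + 2)%N.
Variables (col : 'I_n -> 'I_3) (block_gt1 : forall i, (1 < #|block col i|)%N).
Variables (p : 'I_n -> 'rV[R]_d) (A B : 'I_n -> R) (tt ss : {mpoly R[n]}).
Let K := simplex_join block_gt1.
Let I := affine_ideal K p.
Implicit Types (f g h : {mpoly R[n]}) (q : {poly R}).
Local Notation tob := (to_binary A B).
Local Notation bp := (binary_part A B).

Lemma ideal_mull f g : g \in I -> f * g \in I.
Proof. exact: idealMr. Qed.

Lemma ideal_mulr f g : f \in I -> f * g \in I.
Proof. by rewrite mulrC; exact: idealMr. Qed.

Lemma ideal_scale c f : f \in I -> c *: f \in I.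
Proof. by rewrite -mul_mpolyC; exact: idealMr. Qed.

Lemma ideal_add f g : f \in I -> g \in I -> f + g \in I.
Proof. exact: rpredD. Qed.

Lemma ideal_sub f g : f \in I -> g \in I -> f - g \in I.
Proof. exact: rpredB. Qed.

Lemma ideal0 : 0 \in I.
Proof. exact: rpred0. Qed.

Definition block_monomial i : {mpoly R[n]} := \prod_(v in block col i) 'X_v.
Definition block_poly i : {poly R} := \prod_(v in block col i) lin_poly A B v.

Lemma block_monomial_ideal i : block_monomial i \in I.
Proof.
apply/affine_gen_ideal/Or31; exists (block col i); split=> //.
by apply/simplex_join_missing; exists i.
Qed.

Lemma to_binary_block i :
  tob (block_monomial i) = (block_poly i)%:P * 'X^#|block col i|.
Proof.
rewrite rmorph_prod (eq_bigr (fun v => (lin_poly A B v)%:P * 'X)) => [|v _].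
  by rewrite big_split prodr_const rmorph_prod.
exact: to_binaryXU.
Qed.

Lemma block_monomialE i : block_monomial i = 'X_[\sum_(v in block col i) U_(v)].
Proof. exact: prod_mpolyX. Qed.

Lemma block_monomial_homog i : block_monomial i \is #|block col i|.-homog.
Proof.
rewrite block_monomialE dhomogX /= mdeg_sum (eq_bigr (fun=> 1%N)) ?sum1_card //.
by move=> v _; rewrite mdeg1.
Qed.

Lemma binary_part_block i : bp #|block col i| (block_monomial i) = block_poly i.
Proof. by rewrite /binary_part to_binary_block coefCM coefXn eqxx mulr1. Qed.

Hypotheses (depA : affine_dependence p A) (depB : affine_dependence p B).

Lemma to_binary_sum (c : 'I_n -> R) :
  tob (\sum_v c v *: 'X_v) = ((\sum_v c v * A v)%:P + (\sum_v c v * B v) *: 'X)%:P * 'X.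
Proof.
rewrite raddf_sum /= (eq_bigr (fun v => (c v *: lin_poly A B v)%:P * 'X)) => [|v _].
  rewrite -mulr_suml -rmorph_sum; congr (_%:P * _).
  rewrite rmorph_sum scaler_suml -big_split; apply: eq_bigr => v _.
  by rewrite /= /lin_poly scalerDr scalerA -!mul_polyC !polyCM.
by rewrite to_binaryZ to_binaryXU mulrA -polyCM -mul_polyC.
Qed.

Lemma to_binary_theta j : tob (theta p j) = 0.
Proof.
rewrite /theta to_binary_sum.
have z (C : 'I_n -> R) : affine_dependence p C -> \sum_v p v 0 j * C v = 0.
  move=> [_ /matrixP/(_ 0 j)]; rewrite summxE [RHS]mxE => e; rewrite -[RHS]e.
  by apply: eq_bigr => v _; rewrite mxE mulrC.
by rewrite !z // scale0r addr0 !mul0r.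
Qed.

Lemma to_binary_csum : tob (csum R n) = 0.
Proof.
rewrite /csum (eq_bigr (fun v => 1 *: 'X_v)) => [|v _]; last by rewrite scale1r.
rewrite to_binary_sum; under eq_bigr do rewrite mul1r.
under [X in _ + X *: _]eq_bigr do rewrite mul1r.
by case: depA depB => -> _ [-> _]; rewrite scale0r addr0 mul0r.
Qed.

Hypotheses (card0 : #|block col 0| = u) (card1 : #|block col 1| = u).
Local Notation f1 := (block_poly 0).
Local Notation f2 := (block_poly 1).
Local Notation f3 := (block_poly 2).

(** The test for non-membership in low degree. The linear forms map to zero, the third block gives
    multiples of f3, and the other two generators have degree u, so up to degree u they contribute
    only constant multiples of f1 and f2. *)
Lemma ideal_binary_part k f : (k <= u)%N -> f \in I ->
  exists a b, f3 %| bp k f - (a *: f1 + b *: f2) /\ ((k < u)%N -> a = 0 /\ b = 0).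
Proof.
move=> ku /asboolP[s [sG ->]]; elim: s sG => [|[h g] s IH] sG.
  exists 0, 0; rewrite big_nil /binary_part rmorph0 coef0 !scale0r addr0 subr0.
  by rewrite dvdp0.
have [a [b [ab ab0]]] : exists a b, f3 %| bp k (\sum_(hg <- s) hg.1 * hg.2)
    - (a *: f1 + b *: f2) /\ ((k < u)%N -> a = 0 /\ b = 0).
  by apply: IH => hg hs; apply: sG; rewrite inE hs orbT.
suff [a' [b' [e ab0']]] : exists a b, f3 %| bp k (h * g) - (a *: f1 + b *: f2) /\
    ((k < u)%N -> a = 0 /\ b = 0).
  exists (a' + a), (b' + b); split; last first.
    by move=> kl; have [-> ->] := ab0 kl; have [-> ->] := ab0' kl; rewrite addr0.
  rewrite big_cons /= /binary_part rmorphD coefD -/(bp k _) -/(bp k _) !scalerDl.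
  rewrite addrACA opprD addrACA; exact: dvdp_add.
have z g' : tob g' = 0 -> exists a b, f3 %| bp k (h * g') - (a *: f1 + b *: f2) /\
    ((k < u)%N -> a = 0 /\ b = 0).
  move=> g0; exists 0, 0; rewrite /binary_part rmorphM /= g0 mulr0 coef0.
  by rewrite !scale0r addr0 subr0 dvdp0.
have := sG (h, g) (mem_head _ _) => /= -[[t [/simplex_join_missing[i ->] ->]]|[j ->]|->];
  [|exact/z/to_binary_theta|exact/z/to_binary_csum].
rewrite -/(block_monomial i) mulrC (binary_partM _ _ _ _ (block_monomial_homog i)).
rewrite binary_part_block.
have size1 : (size (bp 0 h) <= 1)%N by exact: size_binary_part.
have top c : f3 %| c - (0 *: f1 + 0 *: f2) = (f3 %| c).
  by rewrite !scale0r addr0 subr0.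
case: (ord3P i) => ->; rewrite ?card0 ?card1; last first.
- by exists 0, 0; rewrite top; split=> //; case: ifP; rewrite ?dvdp0 ?dvdp_mulIl.
- have [ek|lk] := eqVneq k u; last first.
    exists 0, 0; rewrite top leqNgt ltn_neqAle lk ku /= dvdp0; split=> //.
  exists 0, (bp 0 h)`_0; rewrite ek leqnn subnn ltnn; split=> //.
  rewrite {1}(size1_polyC size1) mulrC mul_polyC scale0r add0r subrr; exact: dvdp0.
- have [ek|lk] := eqVneq k u; last first.
    exists 0, 0; rewrite top leqNgt ltn_neqAle lk ku /= dvdp0; split=> //.
  exists (bp 0 h)`_0, 0; rewrite ek leqnn subnn ltnn; split=> //.
  rewrite {1}(size1_polyC size1) mulrC mul_polyC scale0r addr0 subrr; exact: dvdp0.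
Qed.

Hypotheses (tt1 : tt \is 1.-homog) (ss1 : ss \is 1.-homog).
Hypotheses (bin_tt : tob tt = 'X) (bin_ss : tob ss = 'X%:P * 'X).
Hypothesis X_ideal : forall v, 'X_v - (A v *: tt + B v *: ss) \in I.

(** Homogenisation to degree [k] in the two surviving forms; a section of [binary_part] on
    polynomials of degree at most [k]. *)
Definition hom k (q : {poly R}) : {mpoly R[n]} :=
  \sum_(i < k.+1) q`_i *: (ss ^+ i * tt ^+ (k - i)).

Lemma homD k q q' : hom k (q + q') = hom k q + hom k q'.
Proof. by rewrite -big_split; apply: eq_bigr => i _; rewrite coefD scalerDl. Qed.

Lemma homZ k c q : hom k (c *: q) = c *: hom k q.
Proof. by rewrite scaler_sumr; apply: eq_bigr => i _; rewrite coefZ scalerA. Qed.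

Lemma hom_homog k q : hom k q \is k.-homog.
Proof.
apply: rpred_sum => i _; apply: rpredZ.
have := dhomogM (dhomogMn i ss1) (dhomogMn (k - i) tt1).
by rewrite !mul1n subnKC // -ltnS.
Qed.

Lemma to_binary_hom k q : (size q <= k.+1)%N -> tob (hom k q) = q%:P * 'X^k.
Proof.
move=> qk; rewrite raddf_sum /= [in RHS](_ : q = \sum_(i < k.+1) q`_i *: 'X^i).
  rewrite rmorph_sum mulr_suml; apply: eq_bigr => i _.
  rewrite to_binaryZ rmorphM !rmorphXn /= bin_tt bin_ss exprMn -mulrA -exprD subnKC //.
    by rewrite mulrA -polyC_exp -polyCM -mul_polyC.
  by rewrite -ltnS.
by apply/polyP=> j; rewrite -poly_def coef_poly; case: ltnP => // kj;
  rewrite nth_default // (leq_trans qk).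
Qed.

Lemma binary_part_hom k q : (size q <= k.+1)%N -> bp k (hom k q) = q.
Proof.
by move=> qk; rewrite /binary_part to_binary_hom // coefCM coefXn eqxx mulr1.
Qed.

Lemma hom_mul_ss k q : ss * hom k q = hom k.+1 ('X * q).
Proof.
rewrite /hom mulr_sumr [RHS]big_ord_recl coefXM scale0r add0r; apply: eq_bigr => i _.
by rewrite -scalerAr mulrA -exprS coefXM.
Qed.

Lemma hom_mul_tt k q : (size q <= k.+1)%N -> tt * hom k q = hom k.+1 q.
Proof.
move=> qk; rewrite /hom mulr_sumr [RHS]big_ord_recr [q`_ord_max]nth_default //= scale0r addr0.
apply: eq_bigr => i _; rewrite -scalerAr mulrCA -exprS /= subSn //.
by rewrite -ltnS.
Qed.

Lemma hom_mpolyX k m : mdeg m = k -> 'X_[m] - hom k (bp k 'X_[m]) \in I.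
Proof.
elim: k m => [m /eqP|k IH m mk].
  rewrite mdeg_eq0 => /eqP ->; rewrite mpolyX0 /hom big_ord1 !expr0 mulr1.
  by rewrite /binary_part rmorph1 coef1 /= coef1 scale1r subrr ideal0.
have [v mv] : exists v, m v != 0%N.
  apply/existsP; rewrite -[[exists _, _]]negbK negb_exists; apply/negP => /forallP m0.
  move: mk; rewrite mdegE big1 // => v _; apply/eqP; exact/negPn/m0.
pose m' := (m - U_(v))%MM.
have mE : m = (U_(v) + m')%MM by rewrite addmC submK // lep1mP.
have mk' : mdeg m' = k by move: mk; rewrite mE mdegD mdeg1 => -[].
have Xh : ('X_v : {mpoly R[n]}) \is 1.-homog by rewrite dhomogX /= mdeg1.
have e : bp k.+1 'X_[m] = lin_poly A B v * bp k 'X_[m'].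
  rewrite mE mpolyXD (binary_partM _ _ _ _ Xh) /= subn1 /=; congr (_ * _).
  by rewrite /binary_part to_binaryXU coefCM coefX eqxx mulr1.
rewrite e; set q := bp k _; have qk : (size q <= k.+1)%N by exact: size_binary_part.
have lE : hom k.+1 (lin_poly A B v * q) = (A v *: tt + B v *: ss) * hom k q.
  rewrite /lin_poly mulrDl mul_polyC -scalerAl homD !homZ -hom_mul_ss.
  by rewrite -hom_mul_tt // mulrDl !scalerAl.
rewrite lE mE mpolyXD.
have -> : 'X_v * 'X_[m'] - (A v *: tt + B v *: ss) * hom k q =
  'X_v * ('X_[m'] - hom k q) + ('X_v - (A v *: tt + B v *: ss)) * hom k q by ring.
by apply: ideal_add; [apply/ideal_mull/IH | apply/ideal_mulr].
Qed.

Lemma ideal_sum (T : Type) (r : seq T) (P : pred T) (F : T -> {mpoly R[n]}) :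
  (forall i, P i -> F i \in I) -> \sum_(i <- r | P i) F i \in I.
Proof. exact: rpred_sum. Qed.

(** Modulo the ideal each variable is a combination of [tt] and [ss], so a form is congruent to the
    homogenisation of its binary part. *)
Lemma binary_part_eq0 k f : f \is k.-homog -> bp k f = 0 -> f \in I.
Proof.
move=> fk f0; suff : f - hom k (bp k f) \in I.
  by rewrite f0 /hom big1 ?subr0 // => i _; rewrite coef0 scale0r.
have {2}-> : f = \sum_(m <- msupp f) f@_m *: 'X_[m] by exact: mpolyE.
have homsum (r : seq 'X_{1..n}) : hom k (bp k (\sum_(m <- r) f@_m *: 'X_[m])) =
    \sum_(m <- r) f@_m *: hom k (bp k 'X_[m]).
  elim: r => [|m r IH]; rewrite ?big_nil ?big_cons.
    rewrite /binary_part rmorph0 coef0 /hom big1 // => i _; by rewrite coef0 scale0r.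
  rewrite /binary_part rmorphD coefD /= homD to_binaryZ coefCM mul_polyC homZ.
  by rewrite -IH.
rewrite homsum {1}[f]mpolyE -sumrB big_seq; apply: ideal_sum => m mf.
by rewrite -scalerBr; apply/ideal_scale/hom_mpolyX/(dhomog_mf fk).
Qed.

Lemma binary_partB k f g : bp k (f - g) = bp k f - bp k g.
Proof. by rewrite /binary_part (raddfB (to_binary A B)) coefD coefN. Qed.

Lemma binary_partD k f g : bp k (f + g) = bp k f + bp k g.
Proof. by rewrite /binary_part (raddfD (to_binary A B)) coefD. Qed.

Lemma binary_partZ k c f : bp k (c *: f) = c *: bp k f.
Proof. by rewrite /binary_part to_binaryZ coefCM mul_polyC. Qed.

(** * Consequences of good position: socle, top degree and stresses *)

Hypothesis card2 : #|block col 2| = 3%N.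
Hypothesis u_ge3 : (3 <= u)%N.
Variables (a b : 'I_n) (s : seq ('I_n * 'I_n)).
Hypotheses (ca : col a = 2) (cb : col b = 2) (nab : a != b).
Hypotheses (s1 : unzip1 s = enum (block col 0)) (s2 : unzip2 s = enum (block col 1)).
Hypothesis good : good_position col a b s A B.

Lemma size_block_poly2 : size f3 = 4%N.
Proof.
have [_ B0 _] := good.
have sl v : v \in block col 2 -> size (lin_poly A B v) = 2%N.
  rewrite inE => /eqP /B0 Bv; rewrite /lin_poly addrC size_polyDl.
    by rewrite size_scale // size_polyX.
  by rewrite size_scale // size_polyX ltnS size_polyC_leq1.
rewrite size_prod => [|v /sl e]; last by rewrite -size_poly_eq0 e.
by rewrite (eq_bigr (fun=> 2%N)) // sum_nat_const card2.
Qed.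

(** Two of the three linear factors of the cubic already suffice. *)
Lemma block_poly_independent al be : f3 %| al *: f1 + be *: f2 -> al = 0 /\ be = 0.
Proof.
have [_ B0 tel] := good; move=> h.
apply: (prod_lin_poly_independent (B0 _ ca) (B0 _ cb) tel).
have e1 : \prod_(z <- s) lin_poly A B z.1 = f1.
  by rewrite /block_poly -big_enum -s1 big_map.
have e2 : \prod_(z <- s) lin_poly A B z.2 = f2.
  by rewrite /block_poly -big_enum -s2 big_map.
rewrite e1 e2; apply: dvdp_trans h.
rewrite /block_poly (bigD1 a) ?inE ?ca //= (bigD1 b) /=; last first.
  by rewrite inE cb eqxx eq_sym.
by rewrite mulrA dvdp_mulIl.
Qed.

Lemma not_ideal_degree_u : exists2 z, z \is u.-homog & z \notin I.
Proof.
have [i i3 hi] := monomial_not_in_span size_block_poly2 f1 f2.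
exists (hom u 'X^i); first exact: hom_homog.
apply/negP => /(ideal_binary_part (leqnn u))[al [be [h _]]].
rewrite binary_part_hom in h; last by rewrite size_polyXn ltnS (leq_trans _ u_ge3) // ltnW.
by case/negP: (hi al be).
Qed.

(** Lift the polynomial of [socle_poly]. Its product with a variable, minus the given combination of
    the first two block monomials, has binary part divisible by f3; subtracting a multiple of the
    third block monomial makes that part zero. *)
Lemma socle_element : exists y, [/\ y \is u.-1.-homog,
  ~~ (f3 %| bp u.-1 y) & forall v, 'X_v * y \in I].
Proof.
have [Y /andP[Y0 Y3] hY] := @socle_poly _ _ size_block_poly2 _ _ block_poly_independent.
have u0 : (0 < u)%N by exact: leq_trans u_ge3.
exists (hom u.-1 Y); have yh := hom_homog u.-1 Y.
(* Degree [u.-1] must accommodate quadratic polynomials, so [u >= 3] is used. *)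
have sY : (size Y <= u.-1.+1)%N by rewrite prednK // (leq_trans Y3).
rewrite binary_part_hom //; split=> // [|v].
  by apply/negP => /dvdp_leq; rewrite Y0 size_block_poly2 ltnNge Y3 => /(_ isT).
have [al [be h]] := hY (A v) (B v).
have Xh : ('X_v : {mpoly R[n]}) \is 1.-homog by rewrite dhomogX /= mdeg1.
pose g := 'X_v * hom u.-1 Y - (al *: block_monomial 0 + be *: block_monomial 1).
have gh : g \is u.-homog.
  have h0 := block_monomial_homog 0; have h1 := block_monomial_homog 1.
  rewrite card0 in h0; rewrite card1 in h1.
  apply: rpredB; first by have := dhomogM Xh yh; rewrite add1n prednK.
  by apply: rpredD; apply: rpredZ.
have bg : bp u g = lin_poly A B v * Y - (al *: f1 + be *: f2).
  have b0 := binary_part_block 0; have b1 := binary_part_block 1.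
  rewrite card0 in b0; rewrite card1 in b1.
  rewrite binary_partB binary_partD !binary_partZ b0 b1 (binary_partM _ _ _ _ Xh) u0.
  rewrite subn1 binary_part_hom // /binary_part to_binaryXU coefCM coefX eqxx mulr1 //.
have h3 : f3 %| bp u g by rewrite bg.
pose q := bp u g %/ f3.
have sq : (size q <= (u - 3).+1)%N.
  rewrite /q size_divp; last by rewrite -size_poly_eq0 size_block_poly2.
  rewrite size_block_poly2 /= -subSn // leq_sub2r //; exact: size_binary_part.
have qh : hom (u - 3) q * block_monomial 2 \is u.-homog.
  have h2 := block_monomial_homog 2; rewrite card2 in h2.
  by have := dhomogM (hom_homog (u - 3) q) h2; rewrite subnK.
have : g - hom (u - 3) q * block_monomial 2 \in I.
  apply: (@binary_part_eq0 u); first exact: rpredB.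
  rewrite binary_partB (binary_partM _ _ _ _ (hom_homog _ _)) leq_subr subKn //.
  have b2 := binary_part_block 2; rewrite card2 in b2.
  by rewrite b2 binary_part_hom // divpK // subrr.
move=> gI; have -> : 'X_v * hom u.-1 Y = (g - hom (u - 3) q * block_monomial 2) +
    (hom (u - 3) q * block_monomial 2 + (al *: block_monomial 0 + be *: block_monomial 1)).
  by rewrite addrA subrK /g subrK.
apply: ideal_add => //; apply: ideal_add; first exact/ideal_mull/block_monomial_ideal.
by apply: ideal_add; apply/ideal_scale/block_monomial_ideal.
Qed.

Lemma X_span v w z : bracket A B v w != 0 ->
  exists c c', 'X_z - (c *: 'X_v + c' *: 'X_w) \in I.
Proof.
move=> br; pose D := bracket A B v w; rewrite -/D in br.
pose c := (A z * B w - B z * A w) / D; pose c' := (B z * A v - A z * B v) / D.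
exists c, c'; pose e x : {mpoly R[n]} := 'X_x - (A x *: tt + B x *: ss).
have -> : 'X_z - (c *: 'X_v + c' *: 'X_w) = e z - c *: e v - c' *: e w.
  have eA : A z = c * A v + c' * A w.
    by move: br; rewrite /c /c' /D /bracket => br'; field.
  have eB : B z = c * B v + c' * B w.
    by move: br; rewrite /c /c' /D /bracket => br'; field.
  rewrite /e eA eB -!mul_mpolyC !(mpolyCD, mpolyCM); ring.
by apply: ideal_sub; [apply: ideal_sub|]; rewrite ?ideal_scale ?X_ideal.
Qed.

(* Modulo I each variable of 'X_[m] is a combination of the two head variables of
   l1 and l2, so it can be traded for a factor of one of the two products. *)
Lemma monomial_ideal l1 l2 : {subset l1 <= block col 0} -> {subset l2 <= block col 1} ->
  forall e m, e * \prod_(v <- l1) 'X_v \in I -> e * \prod_(v <- l2) 'X_v \in I ->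
  (size l1 + size l2 <= (mdeg m).+1)%N -> e * 'X_[m] \in I.
Proof.
have [k lk] := ubnP (size l1 + size l2); elim: k l1 l2 lk => // k IH.
move=> [|v l1] l2 lk sub1 sub2 e m.
  by rewrite big_nil mulr1 => eI _ _; exact: ideal_mulr.
case: l2 lk sub2 => [|w l2] lk sub2.
  by rewrite big_nil mulr1 => _ eI _; exact: ideal_mulr.
move=> e1 e2 lm0; have lm : (size l1 + size l2 < mdeg m)%N.
  have aux (x y k' : nat) : (x.+1 + y.+1 <= k'.+1 -> x + y < k')%N by lia.
  exact: aux lm0.
have [z mz] : exists z, m z != 0%N.
  apply/existsP; rewrite -[[exists _, _]]negbK negb_exists; apply/negP => /forallP m0.
  by move: lm; rewrite mdegE big1 // => y _; apply/eqP; exact/negPn/m0.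
pose m' := (m - U_(z))%MM.
have mE : m = (U_(z) + m')%MM by rewrite addmC submK // lep1mP.
have br : bracket A B v w != 0.
  have [h _ _] := good; apply: h.
    by have := sub1 v (mem_head _ _); rewrite inE => /eqP.
  by have := sub2 w (mem_head _ _); rewrite inE => /eqP.
have [c [c' h]] := X_span z br.
have lm' : (size l1 + size l2 <= mdeg m')%N.
  by move: lm; rewrite mE mdegD mdeg1 ltnS.
have [lkl lkr] : (size l1 + (size l2).+1 < k)%N /\ ((size l1).+1 + size l2 < k)%N.
  have aux (x y : nat) : (x.+1 + y.+1 < k.+1 -> x + y.+1 < k /\ x.+1 + y < k)%N by lia.
  exact: aux lk.
have sub1' : {subset l1 <= block col 0} by move=> x xl; apply: sub1; rewrite inE xl orbT.
have sub2' : {subset l2 <= block col 1} by move=> x xl; apply: sub2; rewrite inE xl orbT.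
have -> : e * 'X_[m] = e * 'X_[m'] * ('X_z - (c *: 'X_v + c' *: 'X_w)) +
    (c *: (e * 'X_v * 'X_[m']) + c' *: (e * 'X_w * 'X_[m'])).
  rewrite mE mpolyXD -!mul_mpolyC; ring.
apply: ideal_add; first exact: ideal_mull.
apply: ideal_add; apply: ideal_scale.
  apply: (IH l1 (w :: l2)) => //=.
  - by move: e1; rewrite big_cons mulrA.
  - by rewrite mulrAC; apply: ideal_mulr.
  - by rewrite [X in (X <= _)%N]addnS ltnS.
apply: (IH (v :: l1) l2) => //=.
- by rewrite mulrAC; apply: ideal_mulr.
- by move: e2; rewrite big_cons mulrA.
Qed.

(** Two coprime binary forms of degree u leave nothing from degree 2u - 1 on. *)
Lemma high_degree_ideal k f : (2 * u <= k.+1)%N -> f \is k.-homog -> f \in I.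
Proof.
move=> uk fk; rewrite [f]mpolyE big_seq; apply: ideal_sum => m mf; apply: ideal_scale.
rewrite -[X in X \in _]mul1r.
apply: (@monomial_ideal (enum (block col 0)) (enum (block col 1))).
- by move=> v; rewrite mem_enum.
- by move=> v; rewrite mem_enum.
- by rewrite mul1r big_enum; exact: block_monomial_ideal.
- by rewrite mul1r big_enum; exact: block_monomial_ideal.
- by rewrite -!cardE card0 card1 addnn -mul2n (dhomog_mf fk).
Qed.

Lemma affine_projP f g :
  affine_proj K p f = affine_proj K p g <-> f - g \in I.
Proof.
rewrite /affine_proj /I.
by split=> [/eqP|h]; [rewrite -Quotient.idealrBE | apply/eqP; rewrite -Quotient.idealrBE].
Qed.

Lemma affine_projM f g :
  affine_proj K p (f * g) = affine_proj K p f * affine_proj K p g.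
Proof. exact: rmorphM. Qed.

Lemma affine_proj0 : affine_proj K p 0 = 0.
Proof. exact: rmorph0. Qed.

(** As [level] speaks about a given top degree, one has to be produced: the nonzero degrees include
    u and are bounded. Levelness would then place the socle element of degree u - 1 in a degree at
    least u. *)
Lemma not_level : ~ level (affine_proj K p).
Proof.
have [z zh zI] := not_ideal_degree_u; have [y [yh f3y Xy]] := socle_element.
pose nz k := `[< exists w, graded_piece (affine_proj K p) k w /\ w <> 0 >].
have nzu : exists k, nz k.
  exists u; apply/asboolP; exists (affine_proj K p z); split; first by exists z.
  by rewrite -affine_proj0 => /affine_projP; rewrite subr0; apply/negP.
have bound k : nz k -> (k <= 2 * u)%N.
  move=> /asboolP[w [[f [fh ->]] w0]]; rewrite leqNgt; apply/negP => uk; apply: w0.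
  rewrite -affine_proj0; apply/affine_projP; rewrite subr0.
  by apply: high_degree_ideal fh; rewrite ltnW // ltnW.
case: (ex_maxnP nzu bound) => k /asboolP nzk kmax lev.
have uk : (u <= k)%N.
  apply: kmax; apply/asboolP; exists (affine_proj K p z); split; first by exists z.
  by rewrite -affine_proj0 => /affine_projP; rewrite subr0; apply/negP.
have top : top_degree (affine_proj K p) k.
  split=> // j kj w hw; apply: contrapT => w0.
  by have := kmax j (asboolT (ex_intro _ w (conj hw w0))); rewrite leqNgt kj.
have [f [fh yf]] : graded_piece (affine_proj K p) k (affine_proj K p y).
  apply/(lev k top) => v; rewrite -affine_projM -affine_proj0.
  by apply/affine_projP; rewrite subr0.
(* Compare parts of degree [u.-1]: [f] has none, so f3 would divide the binary part of [y]. *)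
move/affine_projP: yf => /(ideal_binary_part (leq_pred u))[al [be [h ab0]]].
have u0 : (0 < u)%N by exact: leq_trans u_ge3.
have [al0 be0] : al = 0 /\ be = 0 by apply: ab0; rewrite prednK.
move: h; rewrite al0 be0 !scale0r addr0 subr0 binary_partB.
rewrite (binary_part_homog _ _ fh) ?subr0; first exact/negP.
by rewrite neq_ltn prednK // uk.
Qed.

(** The stress is dual to a functional that is nonzero at the socle element [y]. On a derivative by
    a linear [mu], the pairing with [y] becomes the action of [y * mu], an element of the ideal, and
    is zero. *)
Lemma stress_not_derivative : exists2 l, affine_stress K p u.-1 l &
  forall omega mu, affine_stress K p u omega -> mu \is 1.-homog -> l <> pdiff mu omega.
Proof.
have [y [yh f3y Xy]] := socle_element.
have u0 : (0 < u)%N by exact: leq_trans u_ge3.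
pose Y := bp u.-1 y %% f3.
(* The coefficient is taken at the degree of the residue of [y], so that [phi y] is its nonzero
   leading coefficient. *)
pose phi f : R := (bp u.-1 f %% f3)`_(size Y).-1.
have phi_linear c f g : phi (c *: f + g) = c * phi f + phi g.
  by rewrite /phi binary_partD binary_partZ modpD modpZl coefD coefZ.
have phi_ideal f : f \in I -> phi f = 0.
  move=> /(ideal_binary_part (leq_pred u))[al [be [h ab0]]].
  have [al0 be0] : al = 0 /\ be = 0 by apply: ab0; rewrite prednK.
  by move: h; rewrite al0 be0 !scale0r addr0 subr0 => /modp_eq0P; rewrite /phi => ->; rewrite coef0.
exists (dual_stress u.-1 phi); first exact: dual_stress_affine.
move=> omega mu om mu1 e.
have := dual_stress_pairing phi_linear phi_ideal yh.
rewrite e -pdiffM (affine_stress_ideal om) ?mcoeff0; last first.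
  rewrite [mu]mpolyE mulr_sumr big_seq; apply: ideal_sum => m mm.
  have /mdeg1P[v /eqP ->] : mdeg m == 1%N by rewrite (dhomog_mf mu1 mm).
  by rewrite -scalerAr mulrC; apply/ideal_scale/Xy.
move/esym/eqP; rewrite -[phi y]/(lead_coef Y) lead_coef_eq0.
exact/negP.
Qed.

End AffineIdeal.

(** * The example with blocks of sizes u, u and 3 *)

Section Example.
Variables (R : realType) (u : nat).
Hypothesis u_ge3 : (3 <= u)%N.
Local Notation n := (2 * u + 1 + 2)%N.

Definition color (v : 'I_n) : 'I_3 :=
  if (v < u)%N then 0 else if (v < 2 * u)%N then 1 else 2.

Lemma card_ord_lt k : (k <= n)%N -> #|[set v : 'I_n | (v < k)%N]| = k.
Proof.
move=> kn; rewrite -sum1_card; under eq_bigl do rewrite inE.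
by rewrite -(big_ord_widen _ (fun=> 1%N)) // sum1_card card_ord.
Qed.

Lemma card_block0 : #|block color 0| = u.
Proof.
rewrite -[RHS](@card_ord_lt u); last by lia.
apply: eq_card => v; rewrite !inE /color.
by case: ltnP => // _; case: ltnP.
Qed.

Lemma card_block1 : #|block color 1| = u.
Proof.
have := @card_ord_lt (2 * u) ltac:(lia).
have -> : [set v : 'I_n | (v < 2 * u)%N] = block color 0 :|: block color 1.
  apply/setP=> v; rewrite !inE /color.
  case: (ltnP v u) => [vu|_]; first by rewrite (leq_trans vu) //; lia.
  by case: ltnP.
rewrite cardsU card_block0.
have -> : block color 0 :&: block color 1 = set0.
  by apply/setP=> v; rewrite !inE; case: eqP => // ->.
have aux (x : nat) : (u + x = 2 * u -> x = u)%N by lia.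
by rewrite cards0 subn0 => /aux.
Qed.

Lemma card_block2 : #|block color 2| = 3%N.
Proof.
have -> : block color 2 = ~: [set v : 'I_n | (v < 2 * u)%N].
  apply/setP=> v; rewrite !inE /color.
  case: (ltnP v u) => [vu|_]; first by rewrite (leq_trans vu) //; lia.
  by case: ltnP.
have aux (x : nat) : (2 * u + x = n -> x = 3)%N by lia.
have := cardsC [set v : 'I_n | (v < 2 * u)%N].
by rewrite [RHS]card_ord card_ord_lt; [exact: aux | lia].
Qed.

Lemma card_block i : (#|block color i| <= u)%N /\ (2 < #|block color i|)%N.
Proof.
by case: (ord3P i) => ->; rewrite ?card_block0 ?card_block1 ?card_block2.
Qed.

Definition block_gt1 i : (1 < #|block color i|)%N := ltnW (card_block i).2.
Definition example : complex n := simplex_join block_gt1.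

Let lt_n k : (k < (2 * u).+3 -> k < n)%N. Proof. by lia. Qed.
Let i0 : 'I_n := Ordinal (lt_n (ltn0Sn _)).
Let i1_lt : (u < (2 * u).+3)%N. Proof. by lia. Qed.
Let i1 : 'I_n := Ordinal (lt_n i1_lt).
Let a_lt : (2 * u < (2 * u).+3)%N. Proof. by lia. Qed.
Let a : 'I_n := Ordinal (lt_n a_lt).
Let b_lt : ((2 * u).+1 < (2 * u).+3)%N. Proof. by lia. Qed.
Let b : 'I_n := Ordinal (lt_n b_lt).
Let s := zip (enum (block color 0)) (enum (block color 1)).

Let u_gt0 : (0 < u)%N. Proof. exact: leq_trans u_ge3. Qed.

Let color_i0 : color i0 = 0.
Proof. by rewrite /color /= u_gt0. Qed.

Let color_i1 : color i1 = 1.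
Proof. by rewrite /color /= ltnn ltn_Pmull. Qed.

Let color_a : color a = 2.
Proof. by rewrite /color /= ltnn ltnNge leq_pmull. Qed.

Let color_b : color b = 2.
Proof.
have h1 : ((2 * u).+1 < u)%N = false by lia.
have h2 : ((2 * u).+1 < 2 * u)%N = false by lia.
by rewrite /color /= h1 h2.
Qed.

Let neq_ab : a != b.
Proof. by rewrite -val_eqE /= neq_ltn ltnSn. Qed.

Let size_enum : size (enum (block color 0)) = size (enum (block color 1)).
Proof. by rewrite -!cardE card_block0 card_block1. Qed.

Let unzip1_s : unzip1 s = enum (block color 0).
Proof. by rewrite unzip1_zip // size_enum. Qed.

Let unzip2_s : unzip2 s = enum (block color 1).
Proof. by rewrite unzip2_zip // size_enum. Qed.

Let s_neq0 : s != [::].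
Proof. by rewrite -size_eq0 size_zip -size_enum minnn -cardE card_block0 -lt0n. Qed.

Let s_color : {in s, forall z, color z.1 = 0 /\ color z.2 = 1}.
Proof.
move=> z zs; split; apply/eqP.
  by have := map_f fst zs; rewrite -/(unzip1 s) unzip1_s mem_enum inE.
by have := map_f snd zs; rewrite -/(unzip2 s) unzip2_s mem_enum inE.
Qed.

Lemma example_class : sphere_class u (2 * u) example.
Proof.
apply: simplex_join_class => [|i]; first by rewrite -addnA.
exact: leq_trans (card_block i).1 (leqnSn _).
Qed.

Lemma example_natural : exists p : 'I_n -> 'rV[R]_(2 * u), natural example p.
Proof.
have := @free_sum_exists R n 3 (2 * u) color _ (fun i => (card_block i).2) isT.
by apply; rewrite -addnA.
Qed.

Lemma example_not_level (p : 'I_n -> 'rV[R]_(2 * u)) : generic p \/ natural example p ->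
  ~ level (affine_proj example p) /\
  exists2 l, affine_stress example p u.-1 l &
    forall omega mu, affine_stress example p u omega -> mu \is 1.-homog ->
      l <> pdiff mu omega.
Proof.
move=> hp; set P := \matrix_v p v.
have [D0 good] : \det (gale_mx i0 i1 P) != 0 /\
    good_position color a b s (gale i0 i1 P 0) (gale i0 i1 P 1).
  case: hp => [gp|np]; last first.
    exact: natural_good_position color_i0 color_i1 color_a color_b s_neq0 s_color R p np.
  have [p0 np0] := example_natural.
  exact: generic_good_position color_i0 color_i1 color_a color_b s_neq0 s_color R p0 p np0 gp.
pose D := \det (gale_mx i0 i1 P); rewrite -/D in D0.
pose A := gale i0 i1 P 0; pose B := gale i0 i1 P 1.
have depA : affine_dependence p A by exact: gale_dependence.
have depB : affine_dependence p B by exact: gale_dependence.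
(* The Gale dual is (D, 0) at [i0] and (0, D) at [i1], so these two forms map to t and s. *)
pose tt : {mpoly R[n]} := D^-1 *: 'X_i0; pose ss : {mpoly R[n]} := D^-1 *: 'X_i1.
have tt1 : tt \is 1.-homog by rewrite rpredZ // dhomogX /= mdeg1.
have ss1 : ss \is 1.-homog by rewrite rpredZ // dhomogX /= mdeg1.
have [A0 A1 B0 B1] : [/\ A i0 = D, A i1 = 0, B i0 = 0 & B i1 = D].
  have := gale_diag i0 i1 P 0 0; have := gale_diag i0 i1 P 0 1.
  have := gale_diag i0 i1 P 1 0; have := gale_diag i0 i1 P 1 1.
  by rewrite /= !mul0r !mul1r.
have bin_tt : to_binary A B tt = 'X.
  rewrite to_binaryZ to_binaryXU /lin_poly A0 B0 scale0r addr0 mulrA -!polyCM mulVf //.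
  by rewrite mul1r.
have bin_ss : to_binary A B ss = 'X%:P * 'X.
  rewrite to_binaryZ to_binaryXU /lin_poly A1 B1 add0r mulrA -polyCM.
  by rewrite [_ * (D *: _)]mul_polyC scalerA mulVf // scale1r.
have X_ideal v : 'X_v - (A v *: tt + B v *: ss) \in affine_ideal example p.
  have [c [c1 h]] := gale_span i0 i1 P v.
  pose T := \sum_k c k *: theta p k + c1 *: csum R n.
  have delta (x : R) y : \sum_w ((w == y)%:R * x) *: 'X_w = x *: 'X_y :> {mpoly R[n]}.
    rewrite (bigD1 y) //= eqxx mul1r big1 ?addr0 // => w /negPf ->.
    by rewrite mul0r scale0r.
  have eD : D *: 'X_v = T + A v *: 'X_i0 + B v *: 'X_i1.
    rewrite -delta; under eq_bigr do rewrite mulrC h !scalerDl.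
    rewrite !big_split /= !delta -scaler_sumr; congr (_ + _ *: _ + _ + _).
    under eq_bigr do rewrite scaler_suml; rewrite exchange_big; apply: eq_bigr => k _.
    rewrite scaler_sumr; apply: eq_bigr => w _.
    by rewrite mxE mulrC scalerA.
  have -> : 'X_v - (A v *: tt + B v *: ss) = D^-1 *: T.
    have swap x y : x *: (D^-1 *: 'X_y) = D^-1 *: (x *: 'X_y) :> {mpoly R[n]}.
      by rewrite !scalerA mulrC.
    by rewrite -['X_v](scalerK D0) eD /tt /ss !swap -scalerDr -scalerBr -(addrA T) addrK.
  apply/ideal_scale/ideal_add; last exact/ideal_scale/affine_gen_ideal/Or33.
  by apply: ideal_sum => k _; apply/ideal_scale/affine_gen_ideal/Or32; exists k.
split.
  exact: (@not_level R (2 * u) u color block_gt1 p A B tt ss depA depB card_block0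
    card_block1 tt1 ss1 bin_tt bin_ss X_ideal card_block2 u_ge3 a b s color_a color_b
    neq_ab unzip1_s unzip2_s good).
exact: (@stress_not_derivative R (2 * u) u color block_gt1 p A B tt ss depA depB card_block0
  card_block1 tt1 ss1 bin_tt bin_ss X_ideal card_block2 u_ge3 a b s color_a color_b
  neq_ab unzip1_s unzip2_s good).
Qed.

End Example.

Theorem corollary6p9 (R : realType) (u : nat) (hu : (3 <= u)%N) :
  (exists (n : nat) (K : complex n),
     [/\ sphere_class u (2 * u) K,
         polytopal R (2 * u) K
       & forall p : 'I_n -> 'rV[R]_(2 * u),
           generic p \/ natural K p -> ~ level (affine_proj K p)])
  /\
  ~ (forall (n : nat) (K : complex n), sphere_class (2 * u - u) (2 * u) K ->
     forall p : 'I_n -> 'rV[R]_(2 * u), generic p \/ natural K p ->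
     forall i j : nat, (1 <= j)%N -> (j < i)%N -> (i <= u)%N ->
     forall l : {mpoly R[n]},
       affine_stress K p j l <->
       exists omega mu : {mpoly R[n]},
         [/\ affine_stress K p i omega,
             mu \is (i - j).-homog
           & l = pdiff mu omega]).
Proof.
split.
  exists (2 * u + 1 + 2)%N, (example hu); split.
  - exact: example_class.
  - exact: example_natural.
  - by move=> p /example_not_level[].
have [p hp] := example_natural R hu.
have [_ [l ls lN]] := example_not_level (or_intror hp).
move=> h; have u0 : (0 < u)%N by rewrite (leq_trans _ hu).
have cl : sphere_class (2 * u - u) (2 * u) (example hu).
  have e : (2 * u - u)%N = u by rewrite mul2n -addnn addnK.
  by rewrite e; exact: example_class.
(* The assertion already fails for the consecutive degrees [i = u] and [j = u.-1]. *)
have := (h _ _ cl p (or_intror hp) u u.-1 _ _ (leqnn u) l).1 ls.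
case=> [||omega [mu [om mu1]]]; rewrite ?prednK //.
  by rewrite -ltnS prednK // (ltnW hu).
by apply: lN om _; move: mu1; rewrite -subn1 subKn.
Qed.
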